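(* Let $C$ be an invertible bounded operator on a Hilbert space $H$. Let $\Gamma_C:\mathcal F(H')\to N^*\mathcal F(H)$ be defined by $\Gamma_C(N')=H(\gamma^{Q_{C^{-1}(N)}},-)$ for objects $N'$ of $\mathcal F(H')$, and $$\Gamma_C\big((P_{N_2}TP_{N_1})'|_{N_1'}\big)=\mu_{((CTC^{-1})|_{C^{-1}(N_2)})^*}:H(\gamma^{Q_{C^{-1}(N_1)}},-)\to H(\gamma^{Q_{C^{-1}(N_2)}},-)$$ for $(P_{N_2}TP_{N_1})'|_{N_1'}:N_1'\to N_2'$, where $T:N_2\to N_1$ is linear. Then $(\mathcal F(H'),\mathcal F(H);\Gamma_C)$ is a cross-connection from $\mathcal F(H')$ to $\mathcal F(H)$.
   Context: $H$ is a Hilbert space over $\mathbf K=\mathbb R$ or $\mathbb C$ with dual $H'$. Composition of maps, morphisms and functors is written from left to right ($fg$ means first $f$, then $g$). $R(T)$, $Z(T)$ denote range and kernel; $P_N$ is the orthogonal projection of $H$ onto a finite-dimensional subspace $N$. For a linear map $A:N\to M$ of subspaces, $PAP_M$ (with $R(P)=N$) denotes the operator $x\mapsto A(P(x))$ on $H$. Category with subobjects: a small category with a distinguished subcategory (same objects) of ''inclusions'', which are monomorphisms, at most one between any two objects, inducing a partial order $\subseteq$ on objects, and such that if $f=hg$ with $f,g$ inclusions then $h$ is an inclusion. A cone $\gamma$ with vertex $d=c_\gamma$ assigns to each object $c$ a morphism $\gamma(c):c\to d$ with $\gamma(c')=j\gamma(c)$ for every inclusion $j:c'\to c$; it is normal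 if some $\gamma(c)$ is an isomorphism. A right inverse of an inclusion is a retraction; a normal factorization is $f=quj$ ($q$ retraction, $u$ isomorphism, $j$ inclusion), and $f^\circ=qu$. A normal category is a category with subobjects in which every morphism has a normal factorization, every inclusion has a right inverse, and each object $d$ is the vertex of a normal cone $\gamma$ with $\gamma(d)=1_d$. Normal cones form a semigroup $T\mathcal C$ under $(\gamma\cdot\delta)(c)=\gamma(c)(\delta(c_\gamma))^\circ$. For an epimorphism $h$ from $c_\gamma$, $(\gamma\star h)(c)=\gamma(c)h$. For a normal cone $\gamma$, $H(\gamma,-):\mathcal C\to\mathbf{Set}$ is $H(\gamma,c)=\{\gamma\star f^\circ:f\in\mathcal C(c_\gamma,c)\}$, $H(\gamma,g):\gamma\star f^\circ\mapsto\gamma\star(fg)^\circ$. The normal dual $N^*\mathcal C$ is the full subcategory of the category of functors $\mathcal C\to\mathbf{Set}$ with objects $H(\epsilon,-)$, $\epsilon$ an idempotent of $T\mathcal C$; its inclusions are the natural transformations whose components are set inclusions. Local isomorphism: $\langle c\rangle$ denotes the full subcategory on the subobjects of $c$. An inclusion-preserving functor $F:\mathcal C\to\mathcal D$ of normal categories is a local isomorphism if it is fully faithful and $F|_{\langle c\rangle}$ is an isomorphism from $\langle c\rangle$ onto $\langle F(c)\rangle$ for every object $c$. Let $\mathcal MH(\gamma,-)=\{c:\gamma(c)\text{ is an isomorphism}\}$. A cross-connection $(\mathcal D,\mathcal C;\Gamma)$ from $\mathcal D$ to $\mathcal C$ is a local isomorphism $\Gamma:\mathcal D\to N^*\mathcal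 C$ such that for every object $c$ of $\mathcal C$ there is an object $d$ of $\mathcal D$ with $c\in\mathcal M\Gamma(d)$. $\mathcal F(H)$: the normal category of finite-dimensional subspaces of $H$, all linear maps, and subspace inclusions; $f^\circ$ is $f$ corestricted to its range. For a finite rank operator (linear map) $T$ on $H$, $\gamma^T$ is the normal cone with vertex $R(T)$, $\gamma^T(M)=T|_M:M\to R(T)$; it is idempotent iff $T$ is. For a finite rank idempotent $P$ with range $N$, $H(\gamma^P,M)=\{\gamma^{PAP_M}:A:N\to M\text{ linear}\}$. For finite rank idempotents $P_1,P_2$ and a linear map $S:R(P_2)\to R(P_1)$, $\mu_{S^*}:H(\gamma^{P_1},-)\to H(\gamma^{P_2},-)$ is the natural transformation with components $\mu_{S^*}(M):\gamma^{P_1AP_M}\mapsto\gamma^{P_2SAP_M}$. $\mathcal F(H')$: the normal category of finite-dimensional subspaces of $H'$, linear maps, and subspace inclusions. Its objects are $N'=\{f_n:n\in N\}$, $N$ an object of $\mathcal F(H)$, where $f_n(x)=\langle x,n\rangle$. For an operator $A$ on $H$, $A'$ is its transpose $f\mapsto(x\mapsto f(A(x)))$. The morphisms $N_1'\to N_2'$ are exactly the maps $(P_{N_2}TP_{N_1})'|_{N_1'}$ with $T:N_2\to N_1$ linear, $T$ being unique. For a finite-dimensional subspace $N$ of $H$, $Q_{C^{-1}(N)}$ is the idempotent operator on $H$ with range $C^{-1}(N)$ and kernel $C^{-1}(N^\perp)$. With left-to-right composition, $(CTC^{-1})|_{C^{-1}(N_2)}:C^{-1}(N_2)\to C^{-1}(N_1)$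 is $x\mapsto C^{-1}(T(C(x)))$. *)

(* Defs.v *)
From HB Require Import structures.
From mathcomp Require Import all_boot all_order all_algebra complex.
From mathcomp Require Import all_classical all_reals topology normedtype.

Set Implicit Arguments.
Unset Strict Implicit.
Unset Printing Implicit Defensive.

Import Order.TTheory GRing.Theory Num.Theory numFieldNormedType.Exports.

Local Open Scope classical_set_scope.
Local Open Scope ring_scope.

Record category := Category {
  ob :> Type;
  hom : ob -> ob -> Type;
  idm : forall c, hom c c;
  mcomp : forall a b c, hom a b -> hom b c -> hom a c;
  mcomp1m : forall a b (f : hom a b), mcomp (idm a) f = f;
  mcompm1 : forall a b (f : hom a b), mcomp f (idm b) = f;
  mcompA : forall a b c d (f : hom a b) (g : hom b c) (h : hom c d),
    mcomp f (mcomp g h) = mcomp (mcomp f g) h }.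

Arguments idm {C} c : rename.

(* Diagrammatic order: [f ;; g] is first [f], then [g]. *)
Notation "f ;; g" := (mcomp f g) (at level 40, left associativity).

Definition is_mono (C : category) (a b : C) (f : hom a b) : Prop :=
  forall z (g h : hom z a), g ;; f = h ;; f -> g = h.

Definition is_iso (C : category) (a b : C) (f : hom a b) : Prop :=
  exists g : hom b a, f ;; g = idm a /\ g ;; f = idm b.

(* The order [a \subseteq b] on objects is [exists j : hom a b, incl j]: it is
   reflexive and transitive because the inclusions form a subcategory, and
   antisymmetric by [incl_anti]. *)
Record subcat := SubCat {
  scat :> category;
  incl : forall a b : scat, hom a b -> Prop;
  incl_id : forall a : scat, incl (idm a);
  incl_comp : forall (a b c : scat) (f : hom a b) (g : hom b c),
    incl f -> incl g -> incl (f ;; g);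
  incl_mono : forall (a b : scat) (f : hom a b), incl f -> is_mono f;
  incl_uniq : forall (a b : scat) (f g : hom a b), incl f -> incl g -> f = g;
  incl_anti : forall (a b : scat) (f : hom a b) (g : hom b a),
    incl f -> incl g -> a = b;
  incl_cancel : forall (a b c : scat) (h : hom a b) (g : hom b c),
    incl g -> incl (h ;; g) -> incl h }.

Definition subobj (C : subcat) (a b : C) : Prop := exists j : hom a b, incl j.

Definition is_retraction (C : subcat) (c d : C) (q : hom c d) : Prop :=
  exists2 j : hom d c, incl j & j ;; q = idm d.

Definition normal_factorization (C : subcat) (a b c d : C) (f : hom a d)
    (q : hom a b) (u : hom b c) (j : hom c d) : Prop :=
  [/\ is_retraction q, is_iso u, incl j & f = q ;; u ;; j].

Record cone_to (C : subcat) (d : C) := ConeTo {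
  leg :> forall c : C, hom c d;
  legP : forall (c' c : C) (j : hom c' c), incl j -> leg c' = j ;; leg c }.

Record cone (C : subcat) := Cone { vertex : C; legs :> cone_to vertex }.

Definition is_normal (C : subcat) (d : C) (g : cone_to d) : Prop :=
  exists c, is_iso (g c).

Record ncone (C : subcat) := NCone {
  ncone_cone :> cone C;
  ncone_normal : is_normal ncone_cone }.

Record normalcat := NormalCat {
  ncat :> subcat;
  normal_fact : forall (a d : ncat) (f : hom a d), exists b c
    (q : hom a b) (u : hom b c) (j : hom c d), normal_factorization f q u j;
  incl_split : forall (a b : ncat) (j : hom a b), incl j ->
    exists q : hom b a, j ;; q = idm a;
  normal_cone : forall d : ncat, exists2 g : cone_to d,
    is_normal g & g d = idm d }.

(* A morphism out of [a], together with its codomain. *)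
Record epart (C : subcat) (a : C) := EPart { eim : C; emor : hom a eim }.

(* [e] is the component [q u] of a normal factorization [f = q u j]; it is
   determined by [f], see [epart_uniq]. *)
Definition is_epart (C : subcat) (a d : C) (f : hom a d) (e : epart a) : Prop :=
  exists b (q : hom a b) (u : hom b (eim e)) (j : hom (eim e) d),
    normal_factorization f q u j /\ emor e = q ;; u.

Lemma epart_exists (C : normalcat) (a d : C) (f : hom a d) :
  exists e, is_epart f e.
Proof.
have [b [c [q [u [j nf]]]]] := normal_fact f.
by exists (EPart (q ;; u)); exists b, q, u, j.
Qed.

(* [epi f] is [f^o]. *)
Definition epi (C : normalcat) (a d : C) (f : hom a d) : epart a :=
  projT1 (cid (epart_exists f)).

Lemma epiP (C : normalcat) (a d : C) (f : hom a d) : is_epart f (epi f).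
Proof. exact: projT2 (cid (epart_exists f)). Qed.

Lemma epart_factor (C : subcat) (a d : C) (f : hom a d) e :
  is_epart f e -> exists2 j : hom (eim e) d, incl j & f = emor e ;; j.
Proof. by move=> [b [q [u [j [[_ _ ij ->] ->]]]]]; exists j. Qed.

Lemma epart_split (C : subcat) (a d : C) (f : hom a d) e :
  is_epart f e -> exists s : hom (eim e) a, s ;; emor e = idm _.
Proof.
move=> [b [q [u [j [[[i _ iq] [v [uv vu]] _ _] ->]]]]].
by exists (v ;; i); rewrite -mcompA (mcompA i) iq mcomp1m.
Qed.

Lemma epart_uniq (C : subcat) (a d : C) (f : hom a d) e1 e2 :
  is_epart f e1 -> is_epart f e2 -> e1 = e2.
Proof.
have key e e' : is_epart f e -> is_epart f e' ->
    forall (j : hom (eim e) d), incl j -> f = emor e ;; j ->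
    exists2 h : hom (eim e) (eim e'), incl h & emor e ;; h = emor e'.
  move=> H H' j ij fj; have [s se] := epart_split H.
  have [j' ij' fj'] := epart_factor H'.
  have hj : s ;; emor e' ;; j' = j.
    by rewrite -mcompA -fj' fj mcompA se mcomp1m.
  exists (s ;; emor e').
    by apply: (incl_cancel ij'); rewrite hj.
  by apply: (incl_mono ij'); rewrite -mcompA hj -fj.
move=> H1 H2.
have [j1 ij1 fj1] := epart_factor H1; have [j2 ij2 fj2] := epart_factor H2.
have [h ih e1h] := key _ _ H1 H2 _ ij1 fj1.
have [h' ih' _] := key _ _ H2 H1 _ ij2 fj2.
case: e1 e2 {H1 H2 j1 ij1 fj1 j2 ij2 fj2} h ih e1h h' ih' => d1 m1 [d2 m2] /=.
move=> h ih <- h' /(incl_anti ih) E; case: _ / E h ih {h'} => h ih.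
by rewrite (incl_uniq ih (incl_id d1)) mcompm1.
Qed.

Lemma epi_uniq (C : normalcat) (a d : C) (f : hom a d) e :
  is_epart f e -> epi f = e.
Proof. exact: epart_uniq (epiP f). Qed.

(* [g * h], for [h] the morphism of [e]; it is only used with [e = epi f]. *)
Program Definition cone_star (C : subcat) (g : cone C) (e : epart (vertex g)) :
  cone C := {| vertex := eim e; legs := {| leg := fun c => g c ;; emor e |} |}.
Next Obligation. by move=> C g e c' c j /= ij; rewrite (legP g ij) mcompA. Qed.

Arguments cone_star {C} g e.

(* The product of the semigroup [T C] of normal cones. *)
Definition cone_mul (C : normalcat) (g d : cone C) : cone C :=
  cone_star g (epi (d (vertex g))).

Definition idempotent_cone (C : normalcat) (e : cone C) : Prop :=
  cone_mul e e = e.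

Lemma cone_star_inj (C : subcat) (g : ncone C) (e1 e2 : epart (vertex g)) :
  cone_star g e1 = cone_star g e2 -> e1 = e2.
Proof.
case: (ncone_normal g) => c [v [gv vg]] E.
pose F (k : cone C) := EPart (v ;; k c).
have : F (cone_star g e1) = F (cone_star g e2) by rewrite E.
by rewrite /F /= !mcompA !vg !mcomp1m; case: e1 {E} => ? ?; case: e2 => ? ?.
Qed.

(* A functor to [Set] all of whose values are subsets of a type [U]. *)
Record sfunctor (C : category) (U : Type) := SFunctor {
  sf_ob :> C -> set U;
  sf_mor : forall c d, hom c d -> sf_ob c -> sf_ob d;
  sf_id : forall c x, sf_mor (idm c) x = x;
  sf_comp : forall c d e (f : hom c d) (g : hom d e) x,
    sf_mor (f ;; g) x = sf_mor g (sf_mor f x) }.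

Record nattrans (C : category) (U : Type) (F G : sfunctor C U) := NatTrans {
  nt :> forall c, F c -> G c;
  nt_natural : forall c d (f : hom c d) x,
    nt (sf_mor f x) = sf_mor f (nt x) }.

Lemma sfunctor_ext (C : category) (U : Type) (F G : sfunctor C U) :
  (forall c x, F c x <-> G c x) ->
  (forall c d (f : hom c d) (x : F c) (y : G c), \val x = \val y ->
    \val (sf_mor f x) = \val (sf_mor f y)) -> F = G.
Proof.
case: F G => [F Fm Fi Fc] [G Gm Gi Gc] /= FG.
have {FG} E : F = G by apply/funext => c; apply/seteqP; split=> x /FG.
case: _ / E Gm Gi Gc => Gm Gi Gc E.
have {E} E : Fm = Gm.
  apply: functional_extensionality_dep => c.
  apply: functional_extensionality_dep => d.
  by apply/funext => f; apply/funext => x; apply: val_inj; apply: E.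
case: _ / E Gi Gc => Gi Gc.
by rewrite (Prop_irrelevance Fi Gi) (Prop_irrelevance Fc Gc).
Qed.

Lemma nattrans_ext (C : category) (U : Type) (F G : sfunctor C U)
    (s t : nattrans F G) : (forall c x, s c x = t c x) -> s = t.
Proof.
case: s t => [s sn] [t tn] /= E.
have {E} E : s = t.
  by apply: functional_extensionality_dep => c; apply/funext => x; apply: E.
by case: _ / E tn => tn; rewrite (Prop_irrelevance sn tn).
Qed.

Program Definition nt_id (C : category) (U : Type) (F : sfunctor C U) :
  nattrans F F := {| nt := fun c x => x |}.
Next Obligation. by []. Qed.

Program Definition nt_comp (C : category) (U : Type) (F G K : sfunctor C U)
  (s : nattrans F G) (t : nattrans G K) : nattrans F K :=
  {| nt := fun c x => t c (s c x) |}.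
Next Obligation. by move=> C U F G K s t c d f x /=; rewrite !nt_natural. Qed.

(* [H(g, c)] is the set of the cones [g * f^o] for [f : c_g -> c]. *)
Definition Hob (C : normalcat) (g : cone C) (c : C) : set (cone C) :=
  [set d | exists f : hom (vertex g) c, d = cone_star g (epi f)].

(* The [f] with [x = g * f^o]; it is unique when [g] is normal, see [HinK]. *)
Definition Hrep (C : normalcat) (g : cone C) (c : C) (x : Hob g c) :
  hom (vertex g) c := projT1 (cid (set_mem (valP x))).

Lemma HrepP (C : normalcat) (g : cone C) (c : C) (x : Hob g c) :
  \val x = cone_star g (epi (Hrep x)).
Proof. exact: projT2 (cid (set_mem (valP x))). Qed.

Definition Hin (C : normalcat) (g : cone C) (c : C) (f : hom (vertex g) c) :
  Hob g c := SigSub (mem_set (ex_intro _ f erefl)).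

Lemma epi_inj (C : normalcat) (a d : C) (f g : hom a d) :
  epi f = epi g -> f = g.
Proof.
move=> E; have [j ij ->] := epart_factor (epiP f).
have [j' ij' ->] := epart_factor (epiP g).
by case: _ / E j' ij' => j' ij'; rewrite (incl_uniq ij ij').
Qed.

Lemma HinK (C : normalcat) (g : ncone C) (c : C) (f : hom (vertex g) c) :
  Hrep (Hin f) = f.
Proof. by apply/esym/epi_inj/cone_star_inj; rewrite -HrepP. Qed.

Lemma HrepK (C : normalcat) (g : ncone C) (c : C) (x : Hob g c) :
  Hin (Hrep x) = x.
Proof. by apply: val_inj; rewrite /= [RHS]HrepP. Qed.

(* [H(g, h)] maps [g * f^o] to [g * (f h)^o]. *)
Program Definition Hfun (C : normalcat) (g : ncone C) : sfunctor C (cone C) :=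
  {| sf_ob := Hob g; sf_mor := fun c d h x => Hin (Hrep x ;; h) |}.
Next Obligation. by move=> C g c x /=; rewrite mcompm1 HrepK. Qed.
Next Obligation. by move=> C g c d e f h x /=; rewrite HinK mcompA. Qed.

Record ndual_ob (C : normalcat) := NDualOb {
  ndual_fun :> sfunctor C (cone C);
  ndual_obP : exists2 e : ncone C, idempotent_cone e & ndual_fun = Hfun e }.

Program Definition ndual_cat (C : normalcat) : category :=
  {| ob := ndual_ob C;
     hom := fun F G => nattrans F G;
     idm := fun F => nt_id F;
     mcomp := fun F G K s t => nt_comp s t |}.
Next Obligation. by move=> *; apply: nattrans_ext. Qed.
Next Obligation. by move=> *; apply: nattrans_ext. Qed.
Next Obligation. by move=> *; apply: nattrans_ext. Qed.

Definition nt_incl (C : normalcat) (F G : ndual_cat C) (s : hom F G) : Prop :=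
  forall c x, \val ((s : nattrans F G) c x) = \val x.

Program Definition ndual (C : normalcat) : subcat :=
  {| scat := ndual_cat C; incl := @nt_incl C |}.
Next Obligation. by []. Qed.
Next Obligation.
by move=> C F G K s t sI tI c x; rewrite /= tI sI.
Qed.
Next Obligation.
move=> C F G s sI Z t u E; apply: nattrans_ext => c x; apply: val_inj.
by have /(congr1 (fun v : nattrans Z G => \val (v c x))) /= := E; rewrite !sI.
Qed.
Next Obligation.
by move=> C F G s t sI tI; apply: nattrans_ext => c x; apply: val_inj; rewrite sI tI.
Qed.
Next Obligation.
move=> C [F FP] [G GP] s t sI tI.
have E : F = G.
  apply: sfunctor_ext => [c x|c d f x y xy].
    split=> Fx.
      by have := valP (s c (SigSub (mem_set Fx))); rewrite sI => /set_mem.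
    by have := valP (t c (SigSub (mem_set Fx))); rewrite tI => /set_mem.
  have -> : y = s c x by apply: val_inj; rewrite sI.
  by rewrite -[in RHS](nt_natural s) sI.
by case: _ / E GP {s t sI tI} => GP; rewrite (Prop_irrelevance FP GP).
Qed.
Next Obligation.
move=> C F G K h g gI hgI c x.
by rewrite -[LHS]gI -(hgI c x).
Qed.

(* [M H(g, -)]: the set [{c : g(c) is an isomorphism}] depends on [g] only
   through the functor [H(g, -)]. *)
Definition Mset (C : normalcat) (F : sfunctor C (cone C)) : set C :=
  [set c | exists2 g : ncone C, F = Hfun g & is_iso (g c)].

Record prefunctor (C D : category) := PreFunctor {
  fob :> C -> D;
  fmor : forall a b : C, hom a b -> hom (fob a) (fob b) }.

Arguments fmor {C D} F {a b} f : rename.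

Definition is_functor (C D : category) (F : prefunctor C D) : Prop :=
  (forall a, fmor F (idm a) = idm (F a)) /\
  (forall a b c (f : hom a b) (g : hom b c),
     fmor F (f ;; g) = fmor F f ;; fmor F g).

Definition fully_faithful (C D : category) (F : prefunctor C D) : Prop :=
  forall a b : C, bijective (fun f : hom a b => fmor F f).

Definition is_cat_iso (C D : category) (F : prefunctor C D) : Prop :=
  [/\ is_functor F, bijective F & fully_faithful F].

Definition incl_preserving (C D : subcat) (F : prefunctor C D) : Prop :=
  forall (a b : C) (f : hom a b), incl f -> incl (fmor F f).

Program Definition full_subcategory (C : category) (P : C -> Prop) : category :=
  {| ob := {a : C | P a};
     hom := fun a b => hom (sval a) (sval b);
     idm := fun a => idm (sval a);
     mcomp := fun a b c f g => f ;; g |}.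
Next Obligation. by move=> *; exact: mcomp1m. Qed.
Next Obligation. by move=> *; exact: mcompm1. Qed.
Next Obligation. by move=> *; exact: mcompA. Qed.

Definition ideal (C : subcat) (c : C) : category :=
  full_subcategory (fun a : C => subobj a c).

Lemma subobj_fob (C D : subcat) (F : prefunctor C D) (a c : C) :
  incl_preserving F -> subobj a c -> subobj (F a) (F c).
Proof. by move=> FI [j /FI ij]; exists (fmor F j). Qed.

Definition restrict (C D : subcat) (F : prefunctor C D)
    (FI : incl_preserving F) (c : C) : prefunctor (ideal c) (ideal (F c)) :=
  @PreFunctor (ideal c) (ideal (F c))
    (fun a => exist _ (F (sval a)) (subobj_fob FI (svalP a)))
    (fun a b f => fmor F f).

(* This only depends on the subobject structure of [C] and [D], so [D] may be
   [ndual _] without first proving that the normal dual is a normal category. *)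
Record local_isomorphism (C D : subcat) (F : prefunctor C D) : Prop :=
  LocalIsomorphism {
    li_functor : is_functor F;
    li_incl : incl_preserving F;
    li_ff : fully_faithful F;
    li_ideal : forall c : C, is_cat_iso (restrict li_incl c) }.

Definition cross_connection (D C : normalcat) (G : prefunctor D (ndual C)) :
    Prop :=
  local_isomorphism G /\
  forall c : C, exists d : D, Mset (G d : ndual_ob C) c.

Section Subspaces.
Variables (K : fieldType) (V : lmodType K).

Definition fin_span (A : set V) : Prop :=
  exists n (b : 'I_n -> V),
    A = [set x | exists a : 'I_n -> K, x = \sum_(i < n) a i *: b i].

Record fdsub := FdSub { fdset :> V -> Prop; fdset_span : fin_span fdset }.

Definition submod (A : set V) : Prop :=
  A 0 /\ forall (a : K) x y, A x -> A y -> A (a *: x + y).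

Lemma fin_span_submod (A : set V) : fin_span A -> submod A.
Proof.
move=> [n [b ->]]; split.
  by exists (fun=> 0); rewrite big1// => i _; rewrite scale0r.
move=> c _ _ [a ->] [a' ->]; exists (fun i => c * a i + a' i).
rewrite scaler_sumr -big_split; apply: eq_bigr => i _ /=.
by rewrite scalerDl scalerA.
Qed.

Lemma fdsub_submod (N : fdsub) : submod N.
Proof. exact: fin_span_submod (fdset_span N). Qed.

Lemma fdsub_ext (N M : fdsub) : (forall x, N x <-> M x) -> N = M.
Proof.
case: N M => [N NP] [M MP] /= NM.
have {NM} E : N = M by apply/seteqP; split=> x /NM.
by case: _ / E MP => MP; rewrite (Prop_irrelevance NP MP).
Qed.

Definition fdpred (N : fdsub) : {pred V} := fun x => x \in (fdset N : set V).

Lemma fdpred_closed (N : fdsub) : submod_closed (fdpred N).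
Proof.
have [N0 Nl] := fdsub_submod N; split; first exact: mem_set.
by move=> a x y /set_mem Nx /set_mem Ny; apply: mem_set; exact: Nl.
Qed.

HB.instance Definition _ N :=
  GRing.isSubmodClosed.Build K V (fdpred N) (fdpred_closed N).

Inductive fdvec (N : fdsub) : predArgType := FdVec x & x \in fdpred N.
Definition fdval N (w : fdvec N) : V := let: FdVec x _ := w in x.

HB.instance Definition _ N := [isSub of fdvec N for @fdval N].
HB.instance Definition _ N := [Choice of fdvec N by <:].
HB.instance Definition _ N := [SubChoice_isSubZmodule of fdvec N by <:].
HB.instance Definition _ N := [SubZmodule_isSubLmodule of fdvec N by <:].

Lemma fdval_is_linear N : linear (@fdval N). Proof. by []. Qed.
HB.instance Definition _ N :=
  GRing.isLinear.Build K (fdvec N) V _ (@fdval N) (@fdval_is_linear N).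

Definition to_fdvec (N : fdsub) (x : V) (Nx : N x) : fdvec N :=
  FdVec (mem_set Nx : x \in fdpred N).

Lemma fdvecP N (w : fdvec N) : N (fdval w).
Proof. by case: w => x /= /set_mem. Qed.

Lemma fdval_inj N : injective (@fdval N). Proof. exact: val_inj. Qed.

End Subspaces.

Coercion fdvec : fdsub >-> predArgType.
Arguments to_fdvec {K V N x} Nx.

Lemma linear_ext (K : pzRingType) (U W : lmodType K) (f g : {linear U -> W}) :
  f =1 g -> f = g.
Proof.
move=> /funext; case: f g => [f [[A1] [A2]]] [g [[B1] [B2]]] /= E.
case: _ / E B1 B2 => B1 B2.
by rewrite (Prop_irrelevance A1 B1) (Prop_irrelevance A2 B2).
Qed.

Section Complements.
Variables (K : fieldType) (V : lmodType K).

Lemma submodN (A : set V) x : submod A -> A x -> A (- x).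
Proof.
move=> [A0 Al] Ax; have := Al (-1) x 0 Ax A0.
by rewrite scaleN1r addr0.
Qed.

Lemma submodB (A : set V) x y : submod A -> A x -> A y -> A (x - y).
Proof.
move=> sA Ax Ay; have := sA.2 1 _ _ Ax (submodN sA Ay).
by rewrite scale1r.
Qed.

Lemma submodZ (A : set V) a x : submod A -> A x -> A (a *: x).
Proof.
by move=> sA Ax; have := sA.2 a _ _ Ax sA.1; rewrite addr0.
Qed.

Lemma complement_exists (A : set V) : submod A ->
  exists W : set V, [/\ submod W, forall x, A x -> W x -> x = 0
    & forall x, exists a w, [/\ A a, W w & x = a + w]].
Proof.
move=> sA.
pose P (W : set V) := (forall (a : K) x y, W x -> W y -> W (a *: x + y)) /\
  (forall x, A x -> W x -> x = 0).
have [|W [[Wl AW] Wmax]] := @Zorn_bigcup V P.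
  move=> F FP Ftot; split=> [a x y [X FX Xx] [Y FY Yy]|x Ax [X FX Xx]].
    case: (Ftot _ _ FX FY) => XY.
      by exists Y => //; apply: (FP _ FY).1 => //; exact: XY.
    by exists X => //; apply: (FP _ FX).1 => //; exact: XY.
  exact: (FP _ FX).2.
have W0 : W 0.
  apply: contrapT => W0; apply: (Wmax [set 0]).
    split=> [x Wx|]; last by move/(_ 0 erefl).
    by exfalso; apply: W0; have := Wl (-1) x x Wx Wx; rewrite scaleN1r addNr.
  split=> [a x y -> ->|x _ ->//]; first by rewrite /= scaler0 addr0.
have sW : submod W by [].
exists W; split=> // x; apply: contrapT => nx.
pose W' := [set y | exists a w, W w /\ y = a *: x + w].
apply: (Wmax W').
  split=> [w Ww|sub]; first by exists 0, w; rewrite scale0r add0r.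
  apply: nx; exists 0, x; split; first exact: sA.1.
    by apply: sub; exists 1, 0; rewrite scale1r addr0.
  by rewrite add0r.
split=> [a _ _ [b [w [Ww ->]]] [c [v [Wv ->]]]|y Ay [a [w [Ww yE]]]].
  exists (a * b + c), (a *: w + v); split; first exact: Wl.
  by rewrite scalerDr scalerDl scalerA addrACA.
have [a0|a0] := eqVneq a 0.
  by apply: AW => //; rewrite yE a0 scale0r add0r.
exfalso; apply: nx; exists (a^-1 *: y), (- (a^-1 *: w)); split.
- exact: submodZ.
- by apply: submodN => //; exact: submodZ.
- by rewrite yE scalerDr scalerA mulVf// scale1r addrK.
Qed.

Lemma projection_exists (A : set V) : submod A ->
  exists p : {linear V -> V}, (forall x, A (p x)) /\ (forall x, A x -> p x = x).
Proof.
move=> sA; have [W [sW AW AWV]] := complement_exists sA.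
have /choice [p pP] : forall x, exists a, A a /\ W (x - a).
  by move=> x; have [a [w [Aa Ww ->]]] := AWV x; exists a; rewrite addrC addKr.
have puniq x a : A a -> W (x - a) -> a = p x.
  move=> Aa Wa; apply/eqP; rewrite -subr_eq0; apply/eqP; apply: AW.
    by apply: submodB => //; have [] := pP x.
  have -> : a - p x = (x - p x) - (x - a) by rewrite opprB [RHS]addrC addrA subrK.
  by apply: submodB => //; have [] := pP x.
have plin : linear p.
  move=> a x y; apply/esym/puniq.
    by apply: sA.2; have [] := pP x; have [] := pP y.
  have -> : a *: x + y - (a *: p x + p y) = a *: (x - p x) + (y - p y).
    by rewrite scalerBr opprD addrACA.
  by apply: sW.2; have [] := pP x; have [] := pP y.
pose pL := GRing.isLinear.Build K V V _ p plin.
exists (HB.pack p pL : {linear V -> V}); split=> x /=; first by have [] := pP x.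
by move=> Ax; apply/esym/puniq; rewrite ?subrr//; exact: sW.1.
Qed.

Lemma fin_span_range (U : lmodType K) (N : fdsub U) (f : {linear N -> V}) :
  fin_span (range f).
Proof.
have [n [b Nb]] := fdset_span N.
have bN i : N (b i).
  rewrite Nb; exists (fun j => (i == j)%:R).
  rewrite (bigD1 i)//= eqxx scale1r big1 ?addr0// => j.
  by rewrite eq_sym => /negPf->; rewrite scale0r.
exists n, (fun i => f (to_fdvec (bN i))); apply/seteqP; split=> [_ [x _ <-]|x] /=.
  have := fdvecP x; rewrite Nb => -[a xE]; exists a.
  have -> : x = \sum_i a i *: to_fdvec (bN i).
    by apply: fdval_inj; rewrite xE linear_sum; apply: eq_bigr.
  by rewrite linear_sum; apply: eq_bigr => i _; rewrite linearZ.
move=> [a ->]; exists (\sum_i a i *: to_fdvec (bN i)) => //.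
by rewrite linear_sum; apply: eq_bigr => i _; rewrite linearZ.
Qed.

Lemma fin_span_sub (A : set V) (N : fdsub V) :
  submod A -> (forall x, A x -> N x) -> fin_span A.
Proof.
move=> sA AN; have [p [pA pid]] := projection_exists sA.
have -> : A = range (p \o @fdval K V N); last exact: fin_span_range.
apply/seteqP; split=> [x Ax|_ [x _ <-]] /=; last exact: pA.
by exists (to_fdvec (AN _ Ax)) => //=; rewrite pid.
Qed.

End Complements.

Definition fdrange (K : fieldType) (U V : lmodType K) (N : fdsub U)
  (f : {linear N -> V}) : fdsub V := FdSub (fin_span_range f).

Section FCategory.
Variables (K : fieldType) (V : lmodType K).

Program Definition fd_cat : category :=
  {| ob := fdsub V;
     hom := fun N M => {linear N -> M};
     idm := fun N => (idfun : {linear N -> N});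
     mcomp := fun N M L f g => (g \o f : {linear N -> L}) |}.
Next Obligation. by move=> *; exact: linear_ext. Qed.
Next Obligation. by move=> *; exact: linear_ext. Qed.
Next Obligation. by move=> *; exact: linear_ext. Qed.

Definition fd_incl (N M : fd_cat) (f : hom N M) : Prop :=
  forall x, fdval ((f : {linear _ -> _}) x) = fdval x.

Program Definition fd_subcat : subcat :=
  {| scat := fd_cat; incl := fd_incl |}.
Next Obligation. by []. Qed.
Next Obligation. by move=> N M L f g fI gI x; rewrite [LHS]gI fI. Qed.
Next Obligation.
move=> N M f fI L g h E; apply: linear_ext => x; apply: fdval_inj.
rewrite -(fI (g x)) -(fI (h x)); congr fdval.
exact: (congr1 (fun k : {linear _ -> _} => k x) E).
Qed.
Next Obligation.
by move=> N M f g fI gI; apply: linear_ext => x; apply: fdval_inj; rewrite fI gI.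
Qed.
Next Obligation.
move=> N M f g fI gI; apply: fdsub_ext => x; split=> Hx.
  by rewrite -[x]/(fdval (to_fdvec Hx)) -fI; exact: fdvecP.
by rewrite -[x]/(fdval (to_fdvec Hx)) -gI; exact: fdvecP.
Qed.
Next Obligation.
by move=> N M L h g gI hgI x; rewrite -gI; exact: hgI.
Qed.

Lemma lin_corestrict (U : lmodType K) (f : {linear U -> V}) (M : fdsub V)
  (fM : forall x, M (f x)) : linear (fun x => to_fdvec (fM x) : M).
Proof. by move=> a x y; apply: fdval_inj; rewrite /= linearP. Qed.

Definition corestrict (U : lmodType K) (f : {linear U -> V}) (M : fdsub V)
    (fM : forall x, M (f x)) : {linear U -> M} :=
  HB.pack (fun x => to_fdvec (fM x) : M)
    (GRing.isLinear.Build K U M _ _ (lin_corestrict fM)).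

Lemma fdrangeP (U : lmodType K) (N : fdsub U) (f : {linear N -> V}) x :
  fdrange f (f x).
Proof. by exists x. Qed.

Lemma fd_incl_split (N M : fd_subcat) (j : hom N M) : incl j ->
  exists q : hom M N, j ;; q = idm N.
Proof.
move=> ij; have [p [pN pid]] := projection_exists (fdsub_submod N).
exists (corestrict (f := p \o @fdval K V M) (fun x => pN (fdval x))).
apply: linear_ext => x; apply: fdval_inj => /=.
by rewrite ij pid//; exact: fdvecP.
Qed.

Lemma fd_isoP (N M : fd_subcat) (f : hom N M) :
  (forall x, fdval ((f : {linear _ -> _}) x) = 0 -> fdval x = 0) ->
  (forall y : M, exists x, (f : {linear _ -> _}) x = y) -> is_iso f.
Proof.
pose g : {linear N -> M} := f; rewrite -/g => f0 /choice[h fh].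
have gi x y : g x = g y -> x = y.
  move=> E; have : fdval (x - y) = 0 by apply: f0; rewrite linearB/= E subrr.
  by move=> /eqP; rewrite linearB/= subr_eq0 => /eqP /fdval_inj.
have hl : linear h by move=> a x y; apply: gi; rewrite linearP/= !fh.
have hf x : h (g x) = x by apply: gi; rewrite fh.
exists (HB.pack h (GRing.isLinear.Build K M N _ h hl) : {linear M -> N}).
by split; apply: linear_ext => x /=; [exact: hf|exact: fh].
Qed.

Definition fd_range (N M : fd_subcat) (f : hom N M) : fd_subcat :=
  fdrange (@fdval K V M \o (f : {linear N -> M})).

Definition fd_corange (N M : fd_subcat) (f : hom N M) : hom N (fd_range f) :=
  corestrict (fdrangeP (@fdval K V M \o (f : {linear N -> M}))).

Definition fd_epart (N M : fd_subcat) (f : hom N M) : @epart fd_subcat N :=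
  EPart (fd_corange f).

Lemma fd_epartP (N M : fd_subcat) (f : hom N M) : is_epart f (fd_epart f).
Proof.
pose g : {linear N -> M} := f.
pose Z (x : V) := exists2 n : N, fdval n = x & g n = 0.
have sZ : submod Z.
  split; first by exists 0; rewrite linear0.
  move=> a _ _ [x <- gx] [y <- gy]; exists (a *: x + y); first exact: linearP.
  by rewrite linearP/= gx gy scaler0 addr0.
have [p [pZ pid]] := projection_exists sZ.
have sW : submod (fun x => N x /\ p x = 0).
  have [N0 Nl] := fdsub_submod N.
  split; first by rewrite linear0.
  move=> a x y [Nx px] [Ny py]; split; first exact: Nl.
  by rewrite linearP/= px py scaler0 addr0.
pose W : fdsub V := FdSub (fin_span_sub (N := N) sW (fun x => @proj1 _ _)).
have pN x : N (p x) by have [n <- _] := pZ x; exact: fdvecP.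
have qW (x : N) : W ((@fdval K V N \- (p \o @fdval K V N)) x).
  split=> /=.
    by apply: submodB; [exact: fdsub_submod|exact: fdvecP|exact: pN].
  by rewrite linearB/= (pid (p _)) ?subrr.
have WN (x : W) : N (@fdval K V W x) by have [] := fdvecP x.
pose q : @hom fd_subcat N W := corestrict qW.
pose i : @hom fd_subcat W N := corestrict WN.
have RM (x : fd_range f) : M (@fdval K V (fd_range f) x).
  by have [n _ <-] := fdvecP x; exact: fdvecP.
pose j : @hom fd_subcat (fd_range f) M := corestrict RM.
have ij : incl j by [].
have gp (x : N) y : fdval y = p (fdval x) -> g y = 0.
  by move=> E; have [n nE <-] := pZ (fdval x); congr (g _); apply: fdval_inj; rewrite nE.
have gker (y : N) : g y = 0 -> p (fdval y) = fdval y.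
  by move=> gy; apply: pid; exists y.
exists W, q, (i ;; fd_corange f), j; split; last first.
  apply: linear_ext => x; apply: fdval_inj => /=; congr fdval; rewrite -/g.
  set y := to_fdvec _; have -> : y = x - to_fdvec (pN (fdval x)).
    by apply: fdval_inj.
  by rewrite linearB/= (@gp x (to_fdvec _))// subr0.
split=> //.
- exists i => //; apply: linear_ext => x; apply: fdval_inj => /=.
  by have [_ ->] := fdvecP x; rewrite subr0.
- apply: fd_isoP => [x /= E|y].
    have gy : g (to_fdvec (WN x)) = 0 by apply: fdval_inj.
    by have [_ <-] := fdvecP x; apply/esym; exact: (gker (to_fdvec (WN x))).
  have [n _ nE] := fdvecP y; exists ((q : {linear _ -> _}) n).
  apply: fdval_inj => /=; rewrite -nE /=; congr fdval; rewrite -/g.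
  set z := to_fdvec _; have -> : z = n - to_fdvec (pN (fdval n)).
    by apply: fdval_inj.
  by rewrite linearB/= (@gp n (to_fdvec _))// subr0.
- apply: linear_ext => x; apply: fdval_inj => /=; congr fdval; rewrite -/g.
  set z := to_fdvec _; have -> : z = x - to_fdvec (pN (fdval x)).
    by apply: fdval_inj.
  by rewrite linearB/= (@gp x (to_fdvec _))// subr0.
Qed.

Program Definition fd_cone (T : {linear V -> V}) (N : fdsub V)
    (TN : forall x, N (T x)) : cone_to (N : fd_subcat) :=
  {| leg := fun M => corestrict (f := T \o @fdval K V M) (fun x => TN _) |}.
Next Obligation.
by move=> T N TN M M' j ij; apply: linear_ext => x; apply: fdval_inj; rewrite /= ij.
Qed.

Program Definition fd_normalcat : normalcat := {| ncat := fd_subcat |}.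
Next Obligation.
move=> N M f; have [b [q [u [j [H _]]]]] := fd_epartP f.
by exists b, (fd_range f), q, u, j.
Qed.
Next Obligation. exact: fd_incl_split. Qed.
Next Obligation.
move=> N; have [p [pN pid]] := projection_exists (fdsub_submod N).
have E : fd_cone pN N = idm (N : fd_subcat).
  by apply: linear_ext => x; apply: fdval_inj => /=; rewrite pid//; exact: fdvecP.
exists (fd_cone pN) => //; exists N; rewrite E.
by exists (idm _); rewrite mcomp1m.
Qed.

End FCategory.

Lemma cone_to_ext (C : subcat) (d : C) (g h : cone_to d) :
  (forall c, g c = h c) -> g = h.
Proof.
case: g h => [g gP] [h hP] /= E.
have {E} E : g = h by apply: functional_extensionality_dep.
by case: _ / E hP => hP; rewrite (Prop_irrelevance gP hP).
Qed.

Lemma idempotent_coneP (C : normalcat) (g : cone C) :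
  g (vertex g) = idm (vertex g) -> idempotent_cone g.
Proof.
move=> g1; rewrite /idempotent_cone /cone_mul g1.
have -> : epi (idm (vertex g)) = EPart (idm (vertex g)).
  apply: epi_uniq; exists (vertex g), (idm _), (idm _), (idm _).
  rewrite /normal_factorization /= !mcomp1m; split=> //; split=> //.
  - by exists (idm _); [exact: incl_id|rewrite mcomp1m].
  - by exists (idm _); rewrite mcomp1m.
  - exact: incl_id.
case: g {g1} => d g; rewrite /cone_star /=; congr Cone.
by apply: cone_to_ext => c /=; rewrite mcompm1.
Qed.

Section FiniteRank.
Variables (K : fieldType) (V : lmodType K).

Record finop := FinOp {
  fop :> {linear V -> V};
  foprange : fdsub V;
  foprangeP : (foprange : set V) = range fop }.

Lemma fop_range (T : finop) x : foprange T (T x).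
Proof. by rewrite foprangeP; exists x. Qed.

Definition fopcor (T : finop) : {linear V -> foprange T} :=
  corestrict (fop_range T).

Lemma fopcor_surj (T : finop) (y : foprange T) : exists x, fopcor T x = y.
Proof.
have := fdvecP y; rewrite foprangeP => -[x _ xy].
by exists x; apply: fdval_inj.
Qed.

Definition gamma_cone (T : finop) : cone (fd_normalcat V) :=
  Cone (fd_cone (fop_range T)).

Lemma gamma_normal (T : finop) : is_normal (gamma_cone T).
Proof.
pose Z (x : V) := T x = 0.
have sZ : submod Z.
  split; first exact: linear0.
  by move=> a x y zx zy; rewrite /Z linearP zx zy scaler0 addr0.
have [p [pZ pid]] := projection_exists sZ.
have /choice[h hP] := @fopcor_surj T.
pose s y := h y - p (h y).
have Ts y : T (s y) = fdval y.
  by rewrite linearB/= (pZ (h y)) subr0 -[in RHS](hP y).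
have ps y : p (s y) = 0 by rewrite linearB/= (pid (p _)) ?subrr//; exact: pZ.
have inj x y : p x = 0 -> p y = 0 -> T x = T y -> x = y.
  move=> px py E; apply/eqP; rewrite -subr_eq0.
  by rewrite -(pid (x - y)) ?linearB/= ?px ?py ?subrr// /Z linearB/= E subrr.
have slin : linear s.
  move=> a x y; apply: inj; rewrite ?ps ?linearP/= ?ps ?scaler0 ?addr0 ?Ts//.
pose sL : {linear foprange T -> V} := HB.pack s (GRing.isLinear.Build K _ _ _ _ slin).
exists (fdrange sL : fd_normalcat V); apply: fd_isoP => [x /= Tx|y].
  have [y _ xy] := fdvecP x; move: Tx; rewrite -xy /= Ts => y0.
  have {}y0 : y = 0 by apply: fdval_inj; rewrite y0.
  by rewrite y0; exact: (linear0 sL).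
have Ry : fdrange sL (s y) by exists y.
by exists (to_fdvec Ry); apply: fdval_inj; rewrite /= Ts.
Qed.

Definition gamma (T : finop) : ncone (fd_normalcat V) :=
  NCone (gamma_normal T).

Definition idempotent_op (P : finop) : Prop := forall x, P (P x) = P x.

Lemma gamma_idempotent (P : finop) : idempotent_op P -> idempotent_cone (gamma P).
Proof.
move=> PP; apply: idempotent_coneP; apply: linear_ext => x; apply: fdval_inj.
have := fdvecP x; rewrite foprangeP => -[z _] /= <-; exact: PP.
Qed.

Definition Hgamma (P : finop) (PP : idempotent_op P) : ndual (fd_normalcat V) :=
  NDualOb (ex_intro2 _ _ (gamma P) (gamma_idempotent PP) erefl).

Lemma pap_range (P : finop) (M : fdsub V) (A : {linear foprange P -> M}) :
  (fdrange (@fdval K V M \o A) : set V) = range (@fdval K V M \o A \o fopcor P).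
Proof.
apply/seteqP; split=> _ [x _ <-] /=; last by exists (fopcor P x).
by have [z <-] := fopcor_surj x; exists z.
Qed.

(* [P A P_M : x |-> A (P x)] *)
Definition pap (P : finop) (M : fdsub V) (A : {linear foprange P -> M}) :
  finop := FinOp (pap_range A).

Lemma cone_star_pap (P : finop) (M : fd_normalcat V)
    (A : {linear foprange P -> M}) :
  cone_star (gamma P) (epi (A : @hom (fd_normalcat V) _ M)) =
  gamma (pap A).
Proof.
rewrite (@epi_uniq (fd_normalcat V) _ _ _ _ (fd_epartP A)).
rewrite /cone_star /= /gamma_cone; congr Cone; apply: cone_to_ext => L.
apply: linear_ext => x; apply: fdval_inj => /=; do 2 congr (fdval _).
Qed.

Lemma Hob_pap (P : finop) (M : fd_normalcat V) (A : {linear foprange P -> M}) :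
  Hob (gamma P) M (gamma (pap A)).
Proof. by exists A; rewrite cone_star_pap. Qed.

Lemma Hob_papP (P : finop) (M : fd_normalcat V) (x : Hob (gamma P) M) :
  exists A : {linear foprange P -> M}, \val x = gamma (pap A).
Proof. by exists (Hrep x); rewrite HrepP cone_star_pap. Qed.

Lemma pap_inj (P : finop) (M : fdsub V) (A B : {linear foprange P -> M}) :
  gamma_cone (pap A) = gamma_cone (pap B) -> A = B.
Proof.
move=> E; have [Ap Bp] := (cone_star_pap A, cone_star_pap B).
exact: (epi_inj (cone_star_inj (etrans Ap (etrans E (esym Bp))))).
Qed.

(* The [A] with [x = gamma^{P A P_M}]; it is unique by [pap_inj]. *)
Definition Hop (P : finop) (M : fd_normalcat V) (x : Hob (gamma P) M) :
  {linear foprange P -> M} := projT1 (cid (Hob_papP x)).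

Lemma HopP (P : finop) (M : fd_normalcat V) (x : Hob (gamma P) M) :
  \val x = gamma (pap (Hop x)).
Proof. exact: projT2 (cid (Hob_papP x)). Qed.

Lemma HopE (P : finop) (M : fd_normalcat V) (x : Hob (gamma P) M) :
  Hop x = Hrep x.
Proof. by apply: pap_inj; rewrite -[LHS]HopP HrepP cone_star_pap. Qed.

(* [mu_{S^*} : gamma^{P1 A P_M} |-> gamma^{P2 S A P_M}] *)
Program Definition mu (P1 P2 : finop) (S : {linear foprange P2 -> foprange P1}) :
  nattrans (Hfun (gamma P1)) (Hfun (gamma P2)) :=
  {| nt := fun M x => SigSub (mem_set (Hob_pap (Hop x \o S))) |}.
Next Obligation.
move=> P1 P2 S M L f x.
have nE N (y : Hob (gamma P1) N) :
    SigSub (mem_set (Hob_pap (Hop y \o S))) =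
    Hin (g := gamma P2) ((S : @hom (fd_normalcat V) _ _) ;; Hrep y).
  by apply: val_inj; apply: etrans (esym (cone_star_pap _)) _; rewrite HopE.
rewrite !nE (@HinK _ (gamma P1)); congr Hin.
by rewrite (@HinK _ (gamma P2)) mcompA.
Qed.

End FiniteRank.

Variant scalar_kind := RealScalars | ComplexScalars.

Definition scalars (R : realType) (k : scalar_kind) : numFieldType :=
  match k with RealScalars => R | ComplexScalars => R[i] end.

Definition sconj (R : realType) (k : scalar_kind) : scalars R k -> scalars R k :=
  match k with RealScalars => id | ComplexScalars => @conjc R end.

Lemma sconj0 (R : realType) k : sconj (0 : scalars R k) = 0.
Proof. by case: k => //=; exact: conjc0. Qed.

Lemma sconjD (R : realType) k (x y : scalars R k) :
  sconj (x + y) = sconj x + sconj y.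
Proof. by case: k x y => x y //=; exact: rmorphD. Qed.

Lemma sconjB (R : realType) k (x y : scalars R k) :
  sconj (x - y) = sconj x - sconj y.
Proof. by case: k x y => x y //=; exact: rmorphB. Qed.

Lemma sconj1 (R : realType) k : sconj (1 : scalars R k) = 1.
Proof. by case: k => //=; exact: conjc1. Qed.

Lemma sconjM (R : realType) k (x y : scalars R k) :
  sconj (x * y) = sconj x * sconj y.
Proof. by case: k x y => x y //=; exact: rmorphM. Qed.

Lemma sconjK (R : realType) k : involutive (@sconj R k).
Proof. by case: k => x //=; exact: conjcK. Qed.

Lemma mul_sconj (R : realType) k (x : scalars R k) : x * sconj x = `|x| ^+ 2.
Proof. by case: k x => x /=; [rewrite real_normK ?num_real|rewrite sqr_normc]. Qed.

Record hilbert (R : realType) (k : scalar_kind) := Hilbert {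
  hspace :> completeNormedModType (scalars R k);
  ip : hspace -> hspace -> scalars R k;
  ip_linear : forall a x y z, ip (a *: x + y) z = a * ip x z + ip y z;
  ip_conj : forall x y, ip y x = sconj (ip x y);
  ip_norm : forall x, ip x x = `|x| ^+ 2 }.

Section Dual.
Variables (K : numFieldType) (H : normedModType K).

Definition dual_pred : {pred H -> K^o} :=
  fun f => `[< linear f /\ continuous f >].

Lemma dual_pred_closed : submod_closed dual_pred.
Proof.
split.
  apply/asboolP; split; first by move=> a x y; rewrite scaler0 addr0.
  by move=> x; exact: cvg_cst.
move=> a f g /asboolP[fl fc] /asboolP[gl gc]; apply/asboolP; split.
  move=> b x y; rewrite !fctE fl gl !scalerDr !scalerA (mulrC a b).
  by rewrite addrACA.
by move=> x; apply: cvgD; [apply: cvgZr; exact: fc|exact: gc].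
Qed.

HB.instance Definition _ :=
  GRing.isSubmodClosed.Build K (H -> K^o) dual_pred dual_pred_closed.

Inductive dual : predArgType := Dual f & f \in dual_pred.
Definition dualfun (f : dual) : H -> K^o := let: Dual g _ := f in g.

HB.instance Definition _ := [isSub of dual for dualfun].
HB.instance Definition _ := [Choice of dual by <:].
HB.instance Definition _ := [SubChoice_isSubZmodule of dual by <:].
HB.instance Definition _ := [SubZmodule_isSubLmodule of dual by <:].

End Dual.
Coercion dualfun : dual >-> Funclass.

Section Riesz.
Variables (R : realType) (k : scalar_kind) (H : hilbert R k).
Local Notation K := (scalars R k).
Implicit Types x y z : H.

Lemma ip0l x : ip 0 x = 0.
Proof. by have := ip_linear 1 0 0 x; rewrite scaler0 addr0 mul1r => /esym /eqP;
  rewrite -subr_eq0 addrK => /eqP. Qed.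

Lemma ipDl x y z : ip (x + y) z = ip x z + ip y z.
Proof. by rewrite -[x]scale1r ip_linear mul1r scale1r. Qed.

Lemma ipZl a x z : ip (a *: x) z = a * ip x z.
Proof. by rewrite -[a *: x]addr0 ip_linear ip0l addr0. Qed.

Lemma ipBl x y z : ip (x - y) z = ip x z - ip y z.
Proof. by rewrite -scaleN1r ipDl ipZl mulN1r. Qed.

Lemma ipZr a x z : ip x (a *: z) = sconj a * ip x z.
Proof. by rewrite ip_conj ipZl sconjM -ip_conj. Qed.

Lemma ipDr x y z : ip x (y + z) = ip x y + ip x z.
Proof. by rewrite ip_conj ipDl sconjD -!ip_conj. Qed.

Lemma ipBr x y z : ip x (y - z) = ip x y - ip x z.
Proof. by rewrite ip_conj ipBl sconjB -!ip_conj. Qed.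

Lemma ip_eq0 x : ip x x = 0 -> x = 0.
Proof. by rewrite ip_norm => /eqP; rewrite sqrf_eq0 normr_eq0 => /eqP. Qed.

Lemma ip_sym0 x y : ip x y = 0 -> ip y x = 0.
Proof. by move=> xy; rewrite ip_conj xy sconj0. Qed.

Lemma cauchy_schwarz x y : `|ip x y| <= `|x| * `|y|.
Proof.
have [->|y0] := eqVneq y 0.
  by rewrite ip_conj ip0l sconj0 !normr0 mulr0.
have yy : ip y y != 0 by apply: contra_neq y0; exact: ip_eq0.
pose c := ip x y / ip y y; pose z := x - c *: y.
have zy : ip z y = 0 by rewrite ipBl ipZl divfK// subrr.
have xE : x = z + c *: y by rewrite subrK.
have xx : `|x| ^+ 2 = `|z| ^+ 2 + (`|c| * `|y|) ^+ 2.
  rewrite -ip_norm {1 2}xE; move: (z) zy => w wy.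
  rewrite ipDl !ipDr !ipZl !ipZr wy (ip_sym0 wy).
  by rewrite !mulr0 addr0 add0r mulrA mul_sconj !ip_norm exprMn.
have cx : `|c| * `|y| <= `|x|.
  rewrite -(@ler_pXn2r _ 2)// ?nnegrE ?mulr_ge0//.
  by rewrite xx lerDr exprn_ge0.
have -> : ip x y = c * ip y y by rewrite divfK.
by rewrite ip_norm normrM normrX normr_id expr2 mulrA ler_wpM2r.
Qed.

Lemma riesz_subproof (n : H) : (fun x => ip x n : K^o) \in @dual_pred K H.
Proof.
have rl : linear (fun x => ip x n : K^o) by move=> a x y; exact: ip_linear.
apply/asboolP; split=> //.
pose r : {linear H -> K^o} := HB.pack (fun x => ip x n : K^o)
  (GRing.isLinear.Build K H K^o _ _ rl).
apply: (@bounded_linear_continuous K H K^o r).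
apply/linear_boundedP; near=> M => x.
apply: (le_trans (cauchy_schwarz x n)); rewrite mulrC ler_wpM2r//.
by near: M; apply: nbhs_pinfty_ge; exact: normr_real.
Unshelve. all: by end_near. Qed.

Definition riesz (n : H) : dual H := Dual (riesz_subproof n).

Lemma rieszE n x : riesz n x = ip x n. Proof. by []. Qed.
End Riesz.

Section OrthogonalProjection.
Variables (R : realType) (k : scalar_kind) (H : hilbert R k).
Implicit Types N : fdsub H.

Definition orth (A : set H) : set H := [set x | forall y, A y -> ip x y = 0].

Lemma orth_span n (b : 'I_n -> H) : exists p : {linear H -> H},
  (forall A, submod A -> (forall i, A (b i)) -> forall x, A (p x)) /\
  (forall x i, ip (x - p x) (b i) = 0).
Proof.
elim: n b => [|n IH] b; first by exists \0; split=> [A sA _ x|x []//]; exact: sA.1.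
have [p [pA pb]] := IH (fun i => b (lift ord0 i)).
have orthA (z : H) : (forall i, ip z (b (lift ord0 i)) = 0) ->
    forall x, ip z (p x) = 0.
  move=> zb x; apply: (pA (fun y => ip z y = 0)) => //; split.
    by apply: ip_sym0; exact: ip0l.
  by move=> a u v zu zv; rewrite ipDr ipZr zu zv mulr0 addr0.
pose w := b ord0 - p (b ord0).
have wb i : ip w (b (lift ord0 i)) = 0 by exact: pb.
have [w0|w0] := eqVneq w 0.
  exists p; split=> [A sA bA|x i]; first by apply: pA.
  case: (unliftP ord0 i) => [j ->|->]; first exact: pb.
  have -> : b ord0 = p (b ord0) by apply/eqP; rewrite -subr_eq0 -/w w0.
  by apply: orthA => j; exact: pb.
have ww : ip w w != 0 by apply: contra_neq w0; exact: ip_eq0.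
pose p' x := p x + (ip x w / ip w w) *: w.
have p'l : linear p'.
  move=> a x y; rewrite /p' linearP/= ip_linear mulrDl scalerDl [a *: (_ + _)]scalerDr.
  by rewrite scalerA mulrA addrACA.
exists (HB.pack p' (GRing.isLinear.Build _ _ _ _ _ p'l) : {linear H -> H}).
split=> [A sA bA x|x i] /=.
  have pxA y : A (p y) by apply: pA.
  rewrite /p' addrC; apply: sA.2; last exact: pxA.
  exact: (submodB sA (bA _) (pxA _)).
have xw : ip (x - p' x) w = 0.
  rewrite /p' opprD addrA ipBl ipBl ipZl divfK// (ip_sym0 (orthA _ wb x)).
  by rewrite subr0 subrr.
have xb j : ip (x - p' x) (b (lift ord0 j)) = 0.
  by rewrite /p' opprD addrA ipBl pb ipZl wb mulr0 subr0.
case: (unliftP ord0 i) => [j ->|->]; first exact: xb.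
by rewrite -[b ord0](subrK (p (b ord0))) ipDr -/w xw orthA ?addr0.
Qed.

Lemma orth_decomposition N : exists p : {linear H -> H},
  (forall x, N (p x)) /\ (forall x, orth N (x - p x)).
Proof.
have [n [b Nb]] := fdset_span N.
have [p [pA pb]] := orth_span b; exists p; split=> x.
  apply: pA; first exact: fdsub_submod.
  move=> i; rewrite Nb; exists (fun j => (i == j)%:R).
  rewrite (bigD1 i)//= eqxx scale1r big1 ?addr0// => j.
  by rewrite eq_sym => /negPf->; rewrite scale0r.
rewrite Nb => _ [a ->]; apply: ip_sym0.
elim/big_ind: _ => [|u v xu xv|i _].
- exact: ip0l.
- by rewrite ipDl xu xv addr0.
- by rewrite ipZl (ip_sym0 (pb _ _)) mulr0.
Qed.

Lemma orth_eq0 N x : N x -> orth N x -> x = 0.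
Proof. by move=> Nx /(_ x Nx) /ip_eq0. Qed.

Lemma oproj_exists N : exists p : {linear H -> H},
  [/\ forall x, p (p x) = p x, (N : set H) = range p
    & [set x | p x = 0] = orth N].
Proof.
have [p [pN pO]] := orth_decomposition N.
have pid x : N x -> p x = x.
  move=> Nx; apply/eqP; rewrite eq_sym -subr_eq0; apply/eqP/orth_eq0/pO.
  by apply: submodB => //; exact: fdsub_submod.
exists p; split=> [x||]; first exact: pid.
  apply/seteqP; split=> [x Nx|_ [x _ <-]//]; by exists x => //; exact: pid.
apply/seteqP; split=> x /=.
  by move=> px; have := pO x; rewrite px subr0.
move=> xO; apply: orth_eq0; first exact: pN.
move=> y Ny; have := pO x y Ny; rewrite ipBl (xO y Ny) sub0r => /eqP.
by rewrite oppr_eq0 => /eqP.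
Qed.

Definition oprojL N : {linear H -> H} := projT1 (cid (oproj_exists N)).

Lemma oprojLP N : [/\ forall x, oprojL N (oprojL N x) = oprojL N x,
  (N : set H) = range (oprojL N) & [set x | oprojL N x = 0] = orth N].
Proof. exact: projT2 (cid (oproj_exists N)). Qed.

Lemma oproj_range N : (N : set H) = range (oprojL N).
Proof. by have [] := oprojLP N. Qed.

(* [P_N] is the idempotent with range [N] and kernel the orthogonal of [N]. *)
Definition oproj N : finop H := FinOp (oproj_range N).

End OrthogonalProjection.

Record invertible_op (R : realType) (k : scalar_kind) (H : hilbert R k) :=
  InvertibleOp {
    iop :> {linear H -> H};
    iop_inv : {linear H -> H};
    iop_continuous : continuous iop;
    iop_inv_continuous : continuous iop_inv;
    iopK : cancel iop iop_inv;
    iop_invK : cancel iop_inv iop }.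

Section Gamma.
Variables (R : realType) (k : scalar_kind) (H : hilbert R k).
Local Notation K := (scalars R k).
Local Notation FH := (fd_normalcat H).
Local Notation FH' := (fd_normalcat (dual H)).

Section Operator.
Variable C : invertible_op H.
Implicit Types N : fdsub H.

Lemma op_preim_span N : fin_span (C @^-1` (N : set H)).
Proof.
have -> : C @^-1` (N : set H) = range (iop_inv C \o @fdval K H N).
  apply/seteqP; split=> [x /= Nx|_ [x _ <-]] /=.
    by exists (to_fdvec Nx) => //=; rewrite iopK.
  by rewrite iop_invK; exact: fdvecP.
exact: fin_span_range.
Qed.

Definition op_preim N : fdsub H := FdSub (op_preim_span N).

Lemma Qop_exists N : exists q : {linear H -> H},
  [/\ forall x, q (q x) = q x, (op_preim N : set H) = range q
    & [set x | q x = 0] = C @^-1` orth N].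
Proof.
have [pp pN p0] := oprojLP N.
exists (iop_inv C \o oprojL N \o C); split=> [x||] /=.
- by rewrite iop_invK pp.
- apply/seteqP; split=> [x /= Nx|_ [x _ <-]] /=.
    have : N (C x) by [].
    by rewrite pN => -[y _ yE]; exists x => //=; rewrite -yE pp yE iopK.
  by rewrite iop_invK pN; exists (C x).
- apply/seteqP; split=> x /=; rewrite -p0 /= => E; last by rewrite E linear0.
  by rewrite -[LHS](iop_invK C) E linear0.
Qed.

Definition QopL N : {linear H -> H} := projT1 (cid (Qop_exists N)).

Lemma QopLP N : [/\ forall x, QopL N (QopL N x) = QopL N x,
  (op_preim N : set H) = range (QopL N)
  & [set x | QopL N x = 0] = C @^-1` orth N].
Proof. exact: projT2 (cid (Qop_exists N)). Qed.

Lemma Qop_range N : (op_preim N : set H) = range (QopL N).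
Proof. by have [] := QopLP N. Qed.

(* [Q_{C^{-1}(N)}] is the idempotent with range [C^{-1}(N)] and kernel the
   preimage under [C] of the orthogonal of [N]. *)
Definition Qop N : finop H := FinOp (Qop_range N).

Lemma Qop_idempotent N : idempotent_op (Qop N).
Proof. by have [] := QopLP N. Qed.

Lemma op_conj_subproof N1 N2 (T : {linear N2 -> N1}) (x : op_preim N2) :
  op_preim N1 ((iop_inv C \o @fdval K H N1 \o T \o
    corestrict (f := C \o @fdval K H (op_preim N2)) (M := N2) (@fdvecP _ _ _)) x).
Proof. by rewrite /= /op_preim /= iop_invK; exact: fdvecP. Qed.

(* [x |-> C^{-1}(T(C(x)))], from [C^{-1}(N2)] to [C^{-1}(N1)] *)
Definition op_conj N1 N2 (T : {linear N2 -> N1}) :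
  {linear op_preim N2 -> op_preim N1} := corestrict (op_conj_subproof T).

End Operator.

Lemma dualfunD (f g : dual H) x : (f + g) x = f x + g x. Proof. by []. Qed.
Lemma dualfunZ a (f : dual H) x : (a *: f) x = a * f x. Proof. by []. Qed.

Lemma dual_ext (f g : dual H) : (forall x, f x = g x) -> f = g.
Proof. by move=> /funext fg; apply: val_inj. Qed.

Lemma riesz_inj : injective (@riesz R k H).
Proof.
move=> m n E; apply/eqP; rewrite -subr_eq0; apply/eqP/ip_eq0.
by rewrite ipBr -!rieszE E subrr.
Qed.

Lemma riesz_linear a (m n : H) :
  riesz (a *: m + n) = sconj a *: riesz m + riesz n.
Proof.
by apply: dual_ext => x; rewrite dualfunD dualfunZ !rieszE ipDr ipZr.
Qed.

Lemma riesz0 : riesz (0 : H) = 0.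
Proof. by apply: dual_ext => x; rewrite rieszE ip_conj ip0l sconj0. Qed.

Lemma riesz_sum n (a : 'I_n -> K) (b : 'I_n -> H) :
  riesz (\sum_i a i *: b i) = \sum_i sconj (a i) *: riesz (b i).
Proof.
apply: (big_ind2 (fun x f => riesz x = f)); first exact: riesz0.
  by move=> x _ y _ <- <-; rewrite -[x]scale1r riesz_linear sconj1 !scale1r.
by move=> i _; rewrite -[_ *: b i]addr0 riesz_linear riesz0 addr0.
Qed.

Lemma predual_span (D : fdsub (dual H)) : fin_span [set n : H | D (riesz n)].
Proof.
have [D0 Dl] := fdsub_submod D.
pose E (f : dual H) := D f /\ exists n, f = riesz n.
have sE : submod E.
  split; first by split=> //; exists 0; rewrite riesz0.
  move=> a f g [Df [m fm]] [Dg [n gn]]; split; first exact: Dl.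
  by exists (sconj a *: m + n); rewrite riesz_linear sconjK fm gn.
have [d [c Ec]] := fin_span_sub sE (fun f => @proj1 _ _).
have cE i : E (c i).
  rewrite Ec; exists (fun j => (i == j)%:R).
  rewrite (bigD1 i)//= eqxx scale1r big1 ?addr0// => j.
  by rewrite eq_sym => /negPf->; rewrite scale0r.
have /choice[b bc] : forall i, exists n, c i = riesz n.
  by move=> i; have [] := cE i.
have sumE (a : 'I_d -> K) :
    riesz (\sum_i a i *: b i) = \sum_i sconj (a i) *: c i.
  by rewrite riesz_sum; apply: eq_bigr => i _; rewrite bc.
exists d, b; apply/seteqP; split=> [n /= Dn|_ [a ->]] /=.
  have : E (riesz n) by split=> //; exists n.
  rewrite Ec => -[a na]; exists (fun i => sconj (a i)); apply: riesz_inj.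
  by rewrite sumE na; apply: eq_bigr => i _; rewrite sconjK.
rewrite sumE; suff : E (\sum_i sconj (a i) *: c i) by case.
by rewrite Ec; exists (fun i => sconj (a i)).
Qed.

Lemma fd_dual_span (N : fdsub H) : fin_span [set riesz n | n in (N : set H)].
Proof.
have [d [b Nb]] := fdset_span N.
exists d, (fun i => riesz (b i)); rewrite Nb; apply/seteqP; split.
  move=> _ [_ [a ->] <-] /=; exists (fun i => sconj (a i)).
  exact: riesz_sum.
move=> _ [a ->] /=; exists (\sum_i sconj (a i) *: b i).
  by exists (fun i => sconj (a i)).
by rewrite riesz_sum; apply: eq_bigr => i _; rewrite sconjK.
Qed.

Definition fd_dual (N : fdsub H) : fdsub (dual H) := FdSub (fd_dual_span N).

(* By the Riesz representation theorem every [D] is [N'] for a unique [N],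
   namely [predual D]. *)
Definition predual (D : fdsub (dual H)) : fdsub H := FdSub (predual_span D).

Lemma fd_dualK : cancel fd_dual predual.
Proof.
move=> N; apply: fdsub_ext => n; split=> /=; last by exists n.
by move=> [m Nm /riesz_inj <-].
Qed.

(* [phi] is the restriction to [D1] of the transpose of [P_{N2} T P_{N1}],
   where [N1 = predual D1] and [N2 = predual D2]. *)
Definition represents (D1 D2 : fdsub (dual H)) (phi : {linear D1 -> D2})
    (T : {linear predual D2 -> predual D1}) : Prop :=
  forall (f : D1) (x : H),
    fdval (phi f) x = fdval f (pap (P := oproj (predual D2)) T x).

Lemma represents_inj (D1 D2 : fdsub (dual H)) (phi : {linear D1 -> D2}) T1 T2 :
  represents phi T1 -> represents phi T2 -> T1 = T2.
Proof.
move=> H1 H2; apply: linear_ext => x; apply: fdval_inj; apply/eqP.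
rewrite -subr_eq0; apply/eqP.
have [p1 p2 p3] := oprojLP (predual D2).
have xp : fopcor (oproj (predual D2)) (fdval x) = x.
  apply: fdval_inj => /=; have := fdvecP x.
  rewrite [X in X _ -> _]p2.
  by move=> [y _ <-]; exact: p1.
apply: (@orth_eq0 _ _ _ (predual D1)).
  by apply: submodB; [exact: fdsub_submod|exact: fdvecP|exact: fdvecP].
move=> n Dn.
pose f : D1 := to_fdvec (Dn : D1 (riesz n)).
have := etrans (esym (H1 f (fdval x))) (H2 f (fdval x)).
have papE (T : {linear predual D2 -> predual D1}) :
    pap (P := oproj (predual D2)) T (fdval x) = fdval (T x).
  by rewrite -[in RHS]xp.
by rewrite !papE /= ipBl => ->; rewrite subrr.
Qed.

(* The [T] representing [phi], unique by [represents_inj]. It always exists; the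
   second branch only makes the definition independent of the Riesz
   representation theorem. *)
Definition represented (D1 D2 : fdsub (dual H)) (phi : {linear D1 -> D2}) :
    {linear predual D2 -> predual D1} :=
  match pselect (exists T, represents phi T) with
  | left e => projT1 (cid e)
  | right _ => \0
  end.

(* See [Gamma_obE] and [Gamma_morE] for the values at [N'] and at the transpose of
   [P_{N2} T P_{N1}]. *)
Definition Gamma (C : invertible_op H) : prefunctor FH' (ndual FH) :=
  @PreFunctor FH' (ndual FH)
    (fun D => Hgamma (Qop_idempotent C (predual D)))
    (fun D1 D2 phi => mu (P1 := Qop C (predual D1)) (P2 := Qop C (predual D2))
       (op_conj C (represented phi))).

Lemma Gamma_obE (C : invertible_op H) (N : fdsub H) :
  Gamma C (fd_dual N : FH') = Hgamma (Qop_idempotent C N).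
Proof. by rewrite /= fd_dualK. Qed.

Lemma Gamma_morE (C : invertible_op H) (D1 D2 : FH') (phi : hom D1 D2) T :
  represents phi T -> fmor (Gamma C) phi =
    mu (P1 := Qop C (predual D1)) (P2 := Qop C (predual D2)) (op_conj C T).
Proof.
move=> phiT; rewrite /= /represented; case: pselect => [e|[]]; last by exists T.
by rewrite (represents_inj (projT2 (cid e)) phiT).
Qed.

End Gamma.

(* Main.v *)
Require Import Defs.
From HB Require Import structures.
From mathcomp Require Import all_boot all_order all_algebra complex ring.
From mathcomp Require Import all_classical all_reals topology normedtype.
Import Defs.

Set Implicit Arguments.
Unset Strict Implicit.
Unset Printing Implicit Defensive.

Import Order.TTheory GRing.Theory Num.Theory numFieldNormedType.Exports.

Local Open Scope classical_set_scope.
Local Open Scope ring_scope.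

(** The normal dual of [F(H)] sees a finite rank operator [T] only through its
    kernel: the functor [H(gamma^T, -)] consists of the cones
    [gamma^{T A P_M}], and [H(gamma^{P1}, M)] is contained in
    [H(gamma^{P2}, M)] for all [M] exactly when [P1] factors through [P2], that
    is, when the kernel of [P2] is contained in that of [P1] ([ker_sub_incl],
    [incl_ker_sub]). The idempotent attached to [N'] has kernel
    [C^{-1}(N^perp)], so on objects [Gamma_C] is the map
    [N |-> C^{-1}(N^perp)] followed by an order anti-isomorphism. This explains
    the behaviour on order ideals. An object of [N^* F(H)] below
    [Gamma_C(N')] is [H(gamma^T, -)] for some [T] whose kernel contains
    [C^{-1}(N^perp)]; a subspace containing [N^perp] is [M^perp] for some [M]
    inside [N] because [N] is finite-dimensional ([orth_above]), and then the
    object is [Gamma_C(M')] ([Gamma_ob_surj]). Injectivity on objects is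
    [orth_anti].

    On morphisms, [Gamma_C] is a composite of three bijections, all compatible
    with composition:
    - a linear map [N1' -> N2'] is the restricted transpose of
      [P_{N2} T P_{N1}] for exactly one [T : N2 -> N1] ([represents_exists],
      [represents_surj]);
    - conjugation [T |-> C T C^{-1}] ([op_conj_inj], [op_conj_surj]);
    - [S |-> mu_{S^*}], which is a bijection onto the natural transformations
      by the Yoneda lemma ([mu_inj], [mu_surj]), as [H(gamma, -)] is
      represented by the vertex of [gamma].
    Hence [Gamma_C] is a fully faithful functor.

    The first of these bijections needs every bounded functional to be of the
    form [ip - n]: otherwise some objects of [F(H')] would not be of the form
    [N']. This is the Riesz representation theorem, the only place where the
    completeness of [H] enters ([riesz_representation]).

    Finally, [N] lies in the M-set of [Gamma_C((C N)')], because the idempotent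
    attached to [C N] has range [C^{-1}(C N) = N] ([Gamma_Mset]). *)

(** * The Riesz representation theorem *)

(** Norms take values in the field of scalars, which is only partially ordered
    in the complex case; nonempty sets of nonnegative scalars nevertheless have
    infima, since their elements are all real. *)
Lemma scalars_inf (R : realType) k (A : set (scalars R k)) : A !=set0 ->
  (forall a, A a -> 0 <= a) ->
  exists d, (forall a, A a -> d <= a) /\
    forall e, 0 < e -> exists2 a, A a & a < d + e.
Proof.
case: k A => /= A [a0 Aa0] A0.
  have iA : has_inf A by split; [exists a0|exists 0].
  exists (inf A); split=> [a Aa|e e0]; first exact: (ge_inf iA.2 Aa).
  have [a Aa ae] := inf_adherent e0 iA; by exists a.
pose B := [set r | A r%:C%C].
have AE a : A a -> a = (complex.Re a)%:C%C.
  by move=> /A0; case: a => x y; rewrite lecE /= => /andP[/eqP-> _].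
have iB : has_inf B.
  split; first by exists (complex.Re a0); rewrite /B /= -AE.
  by exists 0 => r /A0; rewrite lecR.
exists (inf B)%:C%C; split=> [a Aa|e e0].
  rewrite (AE _ Aa) lecR; apply: (ge_inf iB.2); by rewrite /B /= -AE.
have eE : e = (complex.Re e)%:C%C.
  by case: e e0 => x y; rewrite ltcE /= => /andP[/eqP-> _].
have e0' : 0 < complex.Re e by move: e0; rewrite {1}eE ltcR.
have [r Br re] := inf_adherent e0' iB.
by exists r%:C%C => //; rewrite eE -rmorphD ltcR.
Qed.

Section RieszTheorem.
Variables (R : realType) (k : scalar_kind) (H : hilbert R k).
Local Notation K := (scalars R k).
Implicit Types x y z w : H.

Lemma ipNl x y : ip (- x) y = - ip x y.
Proof. by rewrite -scaleN1r ipZl mulN1r. Qed.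

Lemma ipNr x y : ip x (- y) = - ip x y.
Proof. by rewrite -[- y]add0r ipBr ip_conj ip0l sconj0 sub0r. Qed.

Lemma parallelogram x y :
  `|x + y| ^+ 2 + `|x - y| ^+ 2 = `|x| ^+ 2 *+ 2 + `|y| ^+ 2 *+ 2.
Proof.
rewrite -!ip_norm !(ipDl, ipDr, ipNl, ipNr); ring.
Qed.


Lemma pythagoras x y : ip x y = 0 -> `|x + y| ^+ 2 = `|x| ^+ 2 + `|y| ^+ 2.
Proof.
move=> xy; rewrite -!ip_norm ipDl !ipDr xy (ip_sym0 xy).
by rewrite addr0 add0r.
Qed.

(** A functional is determined by its kernel and by one value outside it, so
    it is the inner product with any vector orthogonal to its kernel, suitably
    scaled. The map [v] allows both functionals on [H] itself and functionals
    on a subspace. *)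
Lemma riesz_of_orth (U : lmodType K) (v : {linear U -> H})
    (g : {linear U -> K^o}) (w : U) : g w != 0 -> v w != 0 ->
  (forall u, g u = 0 -> ip (v u) (v w) = 0) ->
  forall u, g u = ip (v u) (v (sconj (g w / ip (v w) (v w)) *: w)).
Proof.
move=> gw0 vw0 orthw x.
have ww : ip (v w) (v w) != 0 by apply: contra_neq vw0; exact: ip_eq0.
have /orthw : g (x - (g x / g w) *: w) = 0.
  by rewrite linearB linearZ /= [_ *: _]divfK// subrr.
rewrite linearB linearZ ipBl ipZl => /eqP; rewrite subr_eq0 => /eqP E.
rewrite linearZ ipZr sconjK E mulrC -mulrA [ip (v w) (v w) * _]mulrC.
by rewrite !divfK.
Qed.

(** A vector [x] that nearly minimises the norm on the hyperplane [f = 1] is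
    nearly orthogonal to the kernel of [f]: subtracting from [x] its component
    along [z] stays in the hyperplane and shortens [x] by that component. *)
Lemma near_min_orth (d e : K) (f : {linear H -> K^o}) x z :
  f x = 1 -> f z = 0 ->
  (forall y, f y = 1 -> d <= `|y| ^+ 2) -> `|x| ^+ 2 < d + e ->
  `|ip x z| ^+ 2 <= e * `|z| ^+ 2.
Proof.
move=> fx fz dmin xe; have [->|z0] := eqVneq z 0.
  by rewrite ip_conj ip0l sconj0 !normr0 expr0n mulr0.
have zz : ip z z != 0 by apply: contra_neq z0; exact: ip_eq0.
pose a := ip x z / ip z z; pose y := x - a *: z.
have xE : ip x z = a * ip z z by rewrite divfK.
have yz : ip y (a *: z) = 0 by rewrite ipZr ipBl ipZl -xE subrr mulr0.
have dy : d <= `|y| ^+ 2.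
  by apply: dmin; rewrite linearB linearZ /= fx fz [_ *: _]mulr0 subr0.
have : `|a| ^+ 2 * `|z| ^+ 2 <= e.
  have := pythagoras yz; rewrite subrK => xy.
  rewrite -exprMn -normrZ -(lerD2l d); apply: le_trans (ltW xe).
  by rewrite xy lerD2r.
move=> ae; rewrite xE ip_norm normrM normrX normr_id exprMn.
by rewrite expr2 mulrA ler_wpM2r ?exprn_ge0.
Qed.

(** Two near-minimisers are close to each other, by the parallelogram law
    applied to their midpoint, which lies in the same hyperplane. *)
Lemma near_min_close (d e : K) (f : {linear H -> K^o}) x y :
  (forall y, f y = 1 -> d <= `|y| ^+ 2) -> f x = 1 -> f y = 1 ->
  `|x| ^+ 2 < d + e -> `|y| ^+ 2 < d + e -> `|x - y| ^+ 2 < e *+ 4.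
Proof.
move=> dmin fx fy xe ye.
have xyd : d *+ 4 <= `|x + y| ^+ 2.
  have /dmin : f (2%:R^-1 *: (x + y)) = 1.
    by rewrite linearZ linearD /= fx fy [_ *: _]mulVf ?pnatr_eq0.
  rewrite normrZ normfV normr_nat exprMn exprVn -natrX.
  by rewrite mulrC ler_pdivlMr ?ltr0n// mulr_natr.
rewrite -(ltrD2l (d *+ 4)).
apply: le_lt_trans (_ : _ <= `|x + y| ^+ 2 + `|x - y| ^+ 2) _.
  by rewrite lerD2r.
have -> : d *+ 4 + e *+ 4 = (d + e) *+ 2 + (d + e) *+ 2.
  by rewrite -mulrnDl -mulrnDr.
rewrite parallelogram.
by apply: ltrD; rewrite ltrMn2r.
Qed.

(** The sets of near-minimisers of the norm on the hyperplane [f = 1] form a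
    Cauchy filter base by [near_min_close]; its limit [w] is orthogonal to the
    kernel of [f] by [near_min_orth]. *)
Theorem riesz_representation (f : dual H) : exists n, f = riesz n.
Proof.
have /asboolP[fl fc] : dualfun f \in @dual_pred K H by exact: valP.
suff [n nE] : exists n, forall x, f x = ip x n.
  by exists n; apply: dual_ext => x; rewrite nE.
pose fL : {linear H -> K^o} :=
  HB.pack (dualfun f) (GRing.isLinear.Build _ _ _ _ _ fl).
have [f0|/existsNP[x0 /eqP fx0]] := pselect (forall x, f x = 0).
  by exists 0 => x; rewrite f0 ip_conj ip0l sconj0.
pose A := [set `|x| ^+ 2 | x in [set x | fL x = 1]].
have [|_ [x _ <-]|d [dmin dinf]] := @scalars_inf R k A.
- exists (`|(f x0)^-1 *: x0| ^+ 2), ((f x0)^-1 *: x0) => //.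
  by rewrite /mkset linearZ /= [_ *: _]mulVf.
- by rewrite exprn_ge0.
have {}dmin y : fL y = 1 -> d <= `|y| ^+ 2 by move=> fy; apply: dmin; exists y.
pose B e := [set x | fL x = 1 /\ `|x| ^+ 2 < d + e].
pose F := filter_from [set e : K | 0 < e] B.
have FF : ProperFilter F.
  apply: filter_from_proper; last first.
    by move=> e /dinf [_ [x fx <-] xe]; exists x.
  apply: filter_from_filter; first by exists 1; exact: ltr01.
  move=> e1 e2 /= e10 e20.
  have sub e e' : e <= e' -> B e `<=` B e'.
    by move=> ee x [fx xe]; split=> //; apply: lt_le_trans xe _; rewrite lerD2l.
  have [e12|/ltW e21] := real_leP (gtr0_real e10) (gtr0_real e20).
    by exists e1 => // x Bx; split=> //; apply: sub Bx.
  by exists e2 => // x Bx; split=> //; apply: sub Bx.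
have FB e : 0 < e -> F (B e) by move=> e0; exists e.
have cF : cauchy F.
  apply/cauchy_ballP => e e0.
  (* [near_min_close] bounds squared distances by four times the excess. *)
  pose e' : K := e ^+ 2 / 4%:R.
  have e'0 : 0 < e' by rewrite divr_gt0 ?exprn_gt0 ?ltr0n.
  exists (B e', B e') => [|[x y] /= [[fx xe] [fy ye]]].
    by split; exact: FB.
  rewrite -ball_normE /ball_ /=.
  rewrite -(@ltr_pXn2r _ 2)// ?nnegrE ?(ltW e0)//.
  have <- : e' *+ 4 = e ^+ 2 by rewrite -[LHS]mulr_natr divfK ?pnatr_eq0.
  exact: near_min_close dmin fx fy xe ye.
have /cvg_ex[w Fw] : cvg F by exact: (@cauchy_cvg _ F FF cF).
have fw : fL w = 1.
  apply: (@cvg_unique K^o _ (fL @ F)).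
  - exact: norm_hausdorff.
  - by apply: cvg_comp Fw _; exact: fc.
  - apply: cvg_near_cst; exists 1; first exact: ltr01.
    by move=> x [].
have wz z : fL z = 0 -> ip z w = 0.
  move=> fz; apply: ip_sym0.
  have [->|z0] := eqVneq z 0; first by apply: ip_sym0; exact: ip0l.
  have zp : 0 < `|z| by rewrite normr_gt0.
  suff small (e : K) : 0 < e -> `|ip w z| < e.
    have [//|wz0] := eqVneq (ip w z) 0.
    by have := small `|ip w z|; rewrite normr_gt0 wz0 ltxx => /(_ isT).
  (* One half of [e] pays for [x] not being orthogonal to [z], the other half
     for replacing [w] by [x]. *)
  move=> e0; pose e' : K := e / (2%:R * `|z|).
  have e'0 : 0 < e' by rewrite divr_gt0// mulr_gt0// ltr0n.
  have [x [[fx xe] wx]] : exists x, B (e' ^+ 2) x /\ `|w - x| < e'.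
    apply: (@filter_ex _ F).
    apply: filterI; first by apply: FB; rewrite exprn_gt0.
    have : nbhs w (ball w e') by exact: nbhsx_ballx.
    by move=> /Fw; rewrite -ball_normE.
  have xz : `|ip x z| <= e' * `|z|.
    rewrite -(@ler_pXn2r _ 2)// ?nnegrE ?(mulr_ge0 (ltW e'0) (normr_ge0 z))//.
    by rewrite exprMn; exact: (near_min_orth fx fz dmin xe).
  have -> : ip w z = ip (w - x) z + ip x z by rewrite -ipDl subrK.
  apply: le_lt_trans (ler_normD _ _) _.
  have -> : e = e' * `|z| + e' * `|z|.
    rewrite -mulr2n -mulr_natl mulrCA divfK// mulf_neq0 ?pnatr_eq0// gt_eqF//.
  apply: ltr_leD xz; apply: le_lt_trans (cauchy_schwarz _ _) _.
  by rewrite ltr_pM2r.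
have gw0 : fL w != 0 by rewrite fw oner_neq0.
exists ((sconj (fL w / ip w w)) *: w).
apply: (@riesz_of_orth H idfun fL w gw0) => //.
by apply: contra_neq gw0 => /= ->; exact: (linear0 fL).
Qed.

(** On a finite-dimensional subspace the algebraic orthogonal projection onto
    the kernel replaces the limit argument, so no continuity is required of the
    functional. *)
Lemma riesz_fd (N : fdsub H) (g : {linear N -> K^o}) :
  exists t : N, forall n : N, g n = ip (fdval n) (fdval t).
Proof.
have [g0|/existsNP[n0 /eqP gn0]] := pselect (forall n, g n = 0).
  by exists 0 => n; rewrite g0; apply/esym/ip_sym0; rewrite linear0 ip0l.
pose Z (x : H) := exists2 n : N, fdval n = x & g n = 0.
have sZ : submod Z.
  split; first by exists 0; rewrite linear0.
  move=> a _ _ [x <- gx] [y <- gy]; exists (a *: x + y); first exact: linearP.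
  by rewrite linearP /= gx gy scaler0 addr0.
have ZN x : Z x -> N x by move=> [n <- _]; exact: fdvecP.
have [p [pZ pO]] := orth_decomposition (FdSub (fin_span_sub sZ ZN)).
have [m mE gm] := pZ (fdval n0).
have gw : g (n0 - m) != 0 by rewrite linearB /= gm subr0.
have wE : fdval (n0 - m) = fdval n0 - p (fdval n0) by rewrite linearB /= mE.
exists (sconj (g (n0 - m) / ip (fdval (n0 - m)) (fdval (n0 - m))) *: (n0 - m)).
apply: (@riesz_of_orth N (@fdval K H N) g) => //=.
  apply: contra_neq gw => /= w0; have -> : n0 - m = 0 by apply: fdval_inj.
  exact: linear0.
move=> z gz; apply: ip_sym0; rewrite -[X in ip X _]/(fdval (n0 - m)) wE.
by apply: pO; exists z.
Qed.
End RieszTheorem.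

(** * Linear maps between the spaces [N'] as restricted transposes *)

Lemma papE (K : fieldType) (V : lmodType K) (P : finop V) (M : fdsub V)
    (T : {linear foprange P -> M}) x : pap T x = fdval (T (fopcor P x)).
Proof. by []. Qed.

Section Transpose.
Variables (R : realType) (k : scalar_kind) (H : hilbert R k).
Local Notation K := (scalars R k).
Implicit Types (N M : fdsub H) (D : fdsub (dual H)) (x y : H).

Lemma oproj_mem N x : N (oprojL N x).
Proof. by have [_ -> _] := oprojLP N; exists x. Qed.

Lemma oproj_id N x : N x -> oprojL N x = x.
Proof. by have [pp -> _] := oprojLP N; move=> [y _ <-]; exact: pp. Qed.

Lemma oproj_orth N x : orth N (x - oprojL N x).
Proof.
have [pp _ kerp] := oprojLP N.
by rewrite -kerp /= linearB /= pp subrr.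
Qed.

Lemma ip_oproj N x y : N y -> ip (oprojL N x) y = ip x y.
Proof.
move=> Ny; apply/esym/eqP; rewrite -subr_eq0 -ipBl.
by apply/eqP/oproj_orth.
Qed.

Lemma oproj_oproj N M x : (forall y, N y -> M y) ->
  oprojL N (oprojL M x) = oprojL N x.
Proof.
move=> NM; have [_ _ kerp] := oprojLP N.
have : oprojL N (x - oprojL M x) = 0.
  rewrite -[_ = 0]/([set z | oprojL N z = 0] _) kerp => y /NM.
  exact: oproj_orth.
by rewrite linearB => /eqP; rewrite subr_eq0 => /eqP/esym.
Qed.

Lemma oproj_cor N (n : N) : fopcor (oproj N) (fdval n) = n.
Proof. by apply: fdval_inj; rewrite /= oproj_id//; exact: fdvecP. Qed.

Lemma fd_ip_inj N (s t : N) :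
  (forall n : N, ip (fdval s) (fdval n) = ip (fdval t) (fdval n)) -> s = t.
Proof.
move=> st; apply: fdval_inj; apply/eqP; rewrite -subr_eq0; apply/eqP/ip_eq0.
by rewrite ipBl -[fdval s - _]linearB !st subrr.
Qed.

(** The conjugate-linear bijection [n |-> f_n] from [N] onto [D = N']. *)
Definition riesz_fdvec D (n : predual D) : D :=
  to_fdvec (fdvecP n : D (riesz (fdval n))).

Lemma riesz_fdvec_surj D (f : D) : exists n : predual D, riesz_fdvec n = f.
Proof.
have [n nE] := riesz_representation (fdval f).
have Dn : predual D n by rewrite /= -nE; exact: fdvecP.
by exists (to_fdvec Dn); apply: fdval_inj; rewrite /= nE.
Qed.

Lemma riesz_fdvec_linear D a (m n : predual D) :
  riesz_fdvec (a *: m + n) = sconj a *: riesz_fdvec m + riesz_fdvec n.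
Proof. by apply: fdval_inj; exact: riesz_linear. Qed.

Lemma dual_oproj D (f : D) x : fdval f x = fdval f (oprojL (predual D) x).
Proof.
have [n <-] := riesz_fdvec_surj f.
by rewrite /= ip_oproj//; exact: (fdvecP n).
Qed.

Lemma dual_linear (f : dual H) a x y : f (a *: x + y) = a * f x + f y.
Proof. by have [n ->] := riesz_representation f; exact: ip_linear. Qed.

Lemma fdval_dualP D a (f g : D) x :
  fdval (a *: f + g) x = a * fdval f x + fdval g x.
Proof. by []. Qed.

(** Both sides of the defining equation of [represents] factor through the
    orthogonal projection onto [N2], so it can be checked on [N2]; and [D1]
    consists of Riesz functionals. *)
Lemma representsE D1 D2 (phi : {linear D1 -> D2})
    (T : {linear predual D2 -> predual D1}) :
  (forall (n : predual D1) (m : predual D2),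
    fdval (phi (riesz_fdvec n)) (fdval m) = ip (fdval (T m)) (fdval n)) ->
  represents phi T.
Proof.
move=> phiT f x; have [n <-] := riesz_fdvec_surj f.
rewrite dual_oproj; exact: (phiT n (fopcor (oproj (predual D2)) x)).
Qed.

(** For fixed [m] in [N2], the conjugate of [n |-> phi(f_n)(m)] is a linear
    functional on [N1]; its Riesz vector is [T m]. *)
Lemma represents_exists D1 D2 (phi : {linear D1 -> D2}) :
  exists T, represents phi T.
Proof.
have /choice[t tE] : forall m : predual D2, exists t : predual D1,
    forall n : predual D1,
    fdval (phi (riesz_fdvec n)) (fdval m) = ip (fdval t) (fdval n).
  move=> m; pose g (n : predual D1) :=
    sconj (fdval (phi (riesz_fdvec n)) (fdval m)).
  have gl : linear (g : _ -> K^o).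
    move=> a n n'; rewrite /g riesz_fdvec_linear linearP.
    by rewrite fdval_dualP sconjD sconjM sconjK.
  have [t tE] := riesz_fd (HB.pack g (GRing.isLinear.Build _ _ _ _ _ gl) :
    {linear predual D1 -> K^o}).
  by exists t => n; rewrite ip_conj -tE /= sconjK.
have tl : linear t.
  move=> a m m'; apply: fd_ip_inj => n.
  by rewrite -tE !linearP /= dual_linear ip_linear -!tE.
exists (HB.pack t (GRing.isLinear.Build _ _ _ _ _ tl) :
  {linear predual D2 -> predual D1}).
exact: representsE.
Qed.

(** The transpose of [P_{N2} T P_{N1}] maps [f_n] to [f_t], where [t] in [N2] is
    the image of [n] under the adjoint of [T]; in particular it maps [N1']
    into [N2']. *)
Lemma represents_surj D1 D2 (T : {linear predual D2 -> predual D1}) :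
  exists phi, represents phi T.
Proof.
have /choice[phi phiE] : forall f : D1, exists g : D2,
    forall x, fdval g x = fdval f (pap (P := oproj (predual D2)) T x).
  move=> f; have [n <-] := riesz_fdvec_surj f.
  pose g (m : predual D2) := ip (fdval (T m)) (fdval n).
  have gl : linear (g : _ -> K^o).
    by move=> a m m'; rewrite /g !linearP ip_linear.
  have [t tE] := riesz_fd (HB.pack g (GRing.isLinear.Build _ _ _ _ _ gl) :
    {linear predual D2 -> K^o}).
  exists (riesz_fdvec t) => x; rewrite dual_oproj.
  exact/esym/(tE (fopcor (oproj (predual D2)) x)).
have phil : linear phi.
  move=> a f g; apply: fdval_inj; apply: dual_ext => x.
  by rewrite phiE !fdval_dualP !phiE.
exists (HB.pack phi (GRing.isLinear.Build _ _ _ _ _ phil) :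
  {linear D1 -> D2}) => f x; exact: phiE.
Qed.

Lemma represents_fun_inj D1 D2 (phi psi : {linear D1 -> D2}) T :
  represents phi T -> represents psi T -> phi = psi.
Proof.
move=> phiT psiT; apply: linear_ext => f; apply: fdval_inj.
by apply: dual_ext => x; rewrite phiT psiT.
Qed.

Lemma represented_represents D1 D2 (phi : {linear D1 -> D2}) :
  represents phi (represented phi).
Proof.
rewrite /represented; case: pselect => [e|[]]; last exact: represents_exists.
exact: projT2 (cid e).
Qed.

Lemma represents_id D : represents (idfun : {linear D -> D}) idfun.
Proof. by move=> f x; rewrite /= -dual_oproj. Qed.

Lemma represents_comp D1 D2 D3 (phi : {linear D1 -> D2})
    (psi : {linear D2 -> D3}) T S : represents phi T -> represents psi S ->
  represents (psi \o phi) (T \o S).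
Proof. by move=> phiT psiS f x; rewrite psiS phiT !papE oproj_cor. Qed.

(** The transpose of an inclusion is an orthogonal projection. *)
Lemma represents_incl D1 D2 (phi : {linear D1 -> D2}) T :
  (forall f, fdval (phi f) = fdval f) -> represents phi T ->
  forall m, fdval (T m) = oprojL (predual D1) (fdval m).
Proof.
move=> phiI phiT m.
rewrite -[RHS]/(fdval (fopcor (oproj (predual D1)) (fdval m))).
congr fdval; apply: fd_ip_inj => n; rewrite /= ip_oproj; last exact: (fdvecP n).
have := phiT (riesz_fdvec n) (fdval m).
by rewrite phiI papE oproj_cor => /esym.
Qed.

Lemma predual_sub D1 D2 :
  (forall x, predual D1 x -> predual D2 x) -> forall f, D1 f -> D2 f.
Proof.
move=> sub f; have [n ->] := riesz_representation f; exact: sub.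
Qed.

End Transpose.

(** * Natural transformations between the functors [H(gamma, -)] *)

Lemma inj_surj_bijective (A B : Type) (f : A -> B) :
  injective f -> (forall b, exists a, f a = b) -> bijective f.
Proof.
by move=> fi /choice[g gK]; exists g => // a; apply: fi; rewrite gK.
Qed.

Section Yoneda.
Variable (C : normalcat).

(** [H(g1, -)] is represented by the vertex of [g1], so a natural transformation
    out of it is precomposition with the morphism that represents the image of
    the universal element [g1 * 1^o]. *)
Lemma yoneda (g1 g2 : ncone C) (t : nattrans (Hfun g1) (Hfun g2)) c
    (x : Hob g1 c) :
  t c x = Hin (Hrep (t _ (Hin (idm (vertex g1)))) ;; Hrep x).
Proof.
rewrite -{1}[x]HrepK -[Hrep x in LHS]mcomp1m.
have := nt_natural t (Hrep x) (Hin (idm (vertex g1))).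
by rewrite /= HinK.
Qed.

Lemma ncone_ext (g h : ncone C) : (g : cone C) = h -> g = h.
Proof.
case: g h => [g gP] [h hP] /= E; case: _ / E hP => hP.
by rewrite (Prop_irrelevance gP hP).
Qed.

End Yoneda.

Section Mu.
Variables (K : fieldType) (V : lmodType K).
Local Notation FV := (fd_normalcat V).
Implicit Types P T : finop V.

(** Under the identification of [H(gamma^P, M)] with the linear maps
    [R(P) -> M], [mu_{S^*}] is precomposition with [S]. *)
Lemma muE P1 P2 (S : {linear foprange P2 -> foprange P1}) M
    (x : Hob (gamma P1) M) :
  mu S M x = Hin (g := gamma P2) ((S : @hom FV _ _) ;; Hrep x).
Proof.
apply: val_inj; apply: etrans (esym (cone_star_pap _)) _; by rewrite HopE.
Qed.

Lemma mu_id P : mu (idfun : {linear foprange P -> foprange P}) = nt_id _.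
Proof.
apply: nattrans_ext => M x; rewrite muE.
by rewrite -[RHS](@HrepK _ (gamma P)); congr Hin; exact: linear_ext.
Qed.

Lemma mu_comp P1 P2 P3 (S1 : {linear foprange P2 -> foprange P1})
    (S2 : {linear foprange P3 -> foprange P2}) :
  mu (S1 \o S2) = nt_comp (mu S1) (mu S2).
Proof.
apply: nattrans_ext => M x; rewrite -[RHS]/(mu S2 M (mu S1 M x)).
rewrite !muE (@HinK _ (gamma P2)).
by congr Hin; exact: linear_ext.
Qed.

Lemma mu_inj P1 P2 : injective (@mu K V P1 P2).
Proof.
move=> S S' E.
have := congr1 (fun t : nattrans (Hfun (gamma P1)) (Hfun (gamma P2)) =>
  Hrep (t _ (Hin (g := gamma P1) (idm (foprange P1 : FV))))) E.
by rewrite !muE !(@HinK _ (gamma P2)) !(@HinK _ (gamma P1)) !mcompm1.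
Qed.

Lemma mu_surj P1 P2 (t : nattrans (Hfun (gamma P1)) (Hfun (gamma P2))) :
  exists S, mu S = t.
Proof.
exists (Hrep (t _ (Hin (g := gamma P1) (idm (foprange P1 : FV))))).
by apply: nattrans_ext => M x; rewrite muE [RHS]yoneda.
Qed.

Lemma finop_ext T1 T2 : T1 =1 T2 -> T1 = T2.
Proof.
case: T1 T2 => [T1 N1 N1E] [T2 N2 N2E] /= /linear_ext E.
case: _ / E N2E => N2E.
have E : N1 = N2 by apply: fdsub_ext => x; rewrite N1E N2E.
by case: _ / E N2E => N2E; rewrite (Prop_irrelevance N1E N2E).
Qed.

(** The value of [T] at [x] can be read off the component of [gamma^T] at the
    line spanned by [x]. *)
Lemma gamma_cone_inj T1 T2 : gamma_cone T1 = gamma_cone T2 -> T1 =1 T2.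
Proof.
move=> E x; pose b (_ : 'I_1) := x.
pose L : fdsub V := FdSub (ex_intro _ 1%N (ex_intro _ b erefl)).
have Lx : L x by exists (fun=> 1); rewrite big_ord1 scale1r.
exact: (congr1 (fun g : cone FV =>
  fdval ((g L : {linear L -> vertex g}) (to_fdvec Lx))) E).
Qed.

Lemma ker_factor (U W : lmodType K)
    (f : {linear V -> U}) (g : {linear V -> W}) :
  (forall w, exists x, g x = w) -> (forall x, g x = 0 -> f x = 0) ->
  exists S : {linear W -> U}, forall x, S (g x) = f x.
Proof.
move=> /choice[h gh] gf; pose S w := f (h w).
have Sg x : S (g x) = f x.
  apply/eqP; rewrite -subr_eq0 -linearB; apply/eqP/gf.
  by rewrite linearB /= gh subrr.
have Sl : linear S.
  by move=> a w w'; rewrite -[w]gh -[w']gh -linearP !Sg linearP.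
by exists (HB.pack S (GRing.isLinear.Build _ _ _ _ _ Sl) : {linear W -> U}).
Qed.

(** If [P2 S = P1], then [P2 S A = P1 A], so [mu_{S^*}] does not move the
    cones. *)
Lemma mu_incl P1 P2 (S : {linear foprange P2 -> foprange P1}) :
  (forall x, fdval (S (fopcor P2 x)) = P1 x) ->
  forall M x, \val (mu S M x) = \val x.
Proof.
move=> SE M x; rewrite [RHS]HopP /=; congr gamma_cone; apply: finop_ext => v.
by congr (fdval (Hop x _)); apply: fdval_inj; rewrite /= SE.
Qed.

Lemma ker_sub_incl P1 P2 : (forall x, P2 x = 0 -> P1 x = 0) ->
  exists s : nattrans (Hfun (gamma P1)) (Hfun (gamma P2)),
    forall M x, \val (s M x) = \val x.
Proof.
move=> kerP.
have [|S SE] := @ker_factor _ _ (fopcor P1) (fopcor P2) (@fopcor_surj _ _ P2).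
  move=> x /(congr1 (@fdval _ _ _)) /= P2x; apply: fdval_inj => /=.
  by rewrite kerP.
by exists (mu S); apply: mu_incl => x; rewrite SE.
Qed.

(** An idempotent cone [g] is itself an element of the set
    [H(g, -)] at its vertex. If [H(g, -)] is a subfunctor of [H(gamma^P, -)],
    then [g] is therefore one of the cones [gamma^{P A P_M}], whose operator
    vanishes on the kernel of [P]. *)
Lemma incl_finop (g : ncone FV) P (s : nattrans (Hfun g) (Hfun (gamma P))) :
  idempotent_cone g -> (forall M x, \val (s M x) = \val x) ->
  exists2 T, g = gamma T & forall x, P x = 0 -> T x = 0.
Proof.
move=> gI sI; pose x := Hin (g (vertex g)).
have [A AE] := Hob_papP (s _ x).
exists (pap A).
  by apply: ncone_ext; rewrite -AE sI -[LHS]gI.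
move=> v Pv; rewrite papE; have -> : fopcor P v = 0 by apply: fdval_inj.
by rewrite !linear0.
Qed.

Lemma incl_ker_sub P1 P2 (s : nattrans (Hfun (gamma P1)) (Hfun (gamma P2))) :
  idempotent_op P1 -> (forall M x, \val (s M x) = \val x) ->
  forall x, P2 x = 0 -> P1 x = 0.
Proof.
move=> /gamma_idempotent P1I sI x P2x.
have [T E /(_ x P2x) <-] := incl_finop P1I sI.
by apply: gamma_cone_inj; rewrite -[RHS]/(ncone_cone (gamma T)) -E.
Qed.

End Mu.

(** * Orthogonal complements of finite-dimensional subspaces *)

Section OrthogonalLattice.
Variables (R : realType) (k : scalar_kind) (H : hilbert R k).
Implicit Types (N M : fdsub H) (x y : H).

Lemma orth_anti N M : (forall x, orth M x -> orth N x) -> forall x, N x -> M x.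
Proof.
move=> MN x Nx; have xO := @oproj_orth _ _ _ M x.
suff /ip_eq0 /eqP : ip (x - oprojL M x) (x - oprojL M x) = 0.
  by rewrite subr_eq0 => /eqP ->; exact: oproj_mem.
rewrite ipBr (ip_sym0 (ip_sym0 (MN _ xO _ Nx))) xO ?subr0//.
exact: oproj_mem.
Qed.

(** The orthogonal of [Z] lies in the double orthogonal of [N], which is [N],
    and serves as [M]. That no vector outside [Z] is orthogonal to [M] is where
    finite dimension is used: [Z] is the sum of the orthogonal of [N] and of its
    intersection [L] with [N], and one can project orthogonally onto [L]. *)
Lemma orth_above N (Z : set H) : submod Z -> (forall x, orth N x -> Z x) ->
  exists M, (forall x, M x -> N x) /\ (forall x, Z x <-> orth M x).
Proof.
move=> sZ NZ.
have sN := fdsub_submod N.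
pose A x := N x /\ forall z, Z z -> ip x z = 0.
have sA : submod A.
  split; first by split=> [|z _]; [exact: sN.1|exact: ip0l].
  move=> a x y [Nx xZ] [Ny yZ]; split; first exact: sN.2.
  by move=> z Zz; rewrite ip_linear xZ// yZ// mulr0 addr0.
pose B x := N x /\ Z x.
have sB : submod B.
  split; first by split; [exact: sN.1|exact: sZ.1].
  by move=> a x y [Nx Zx] [Ny Zy]; split; [exact: sN.2|exact: sZ.2].
pose M := FdSub (fin_span_sub (N := N) sA (fun x => @proj1 _ _)).
pose L := FdSub (fin_span_sub (N := N) sB (fun x => @proj1 _ _)).
exists M; split=> [x []//|y]; split=> [Zy x [_ /(_ y Zy)] /ip_sym0//|yM].
pose u := oprojL N y; pose w := u - oprojL L u.
have [NLu ZLu] : B (oprojL L u) by exact: (@oproj_mem _ _ _ L).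
have Nw : N w by apply: submodB => //; exact: oproj_mem.
have Zproj z : Z z -> Z (oprojL N z).
  move=> Zz; have -> : oprojL N z = z - (z - oprojL N z) by rewrite subKr.
  by apply: submodB => //; apply: NZ; exact: oproj_orth.
have Mw : M w.
  split=> // z Zz; apply: ip_sym0; rewrite -(ip_oproj _ Nw); apply: ip_sym0.
  by apply: oproj_orth; split; [exact: oproj_mem|exact: Zproj].
(* [w] is the component of [y] along [M], and [y] is orthogonal to [M]. *)
have w0 : w = 0.
  have uw : ip u w = 0 by rewrite ip_oproj// yM.
  apply: ip_eq0; rewrite {1}/w ipBl uw.
  rewrite (ip_sym0 (@oproj_orth _ _ _ L u _ _)) ?subr0//; exact: oproj_mem.
have uE : oprojL L u = u by apply/esym/eqP; rewrite -subr_eq0 -/w w0.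
have -> : y = 1 *: oprojL L u + (y - u) by rewrite uE scale1r addrC subrK.
by apply: sZ.2 => //; apply: NZ; exact: oproj_orth.
Qed.

End OrthogonalLattice.

(** * Conjugation by the invertible operator *)

Section OpConj.
Variables (R : realType) (k : scalar_kind) (H : hilbert R k).
Variable C : invertible_op H.
Implicit Types (N : fdsub H) (x y : H).

(** An idempotent is determined by its range and kernel, so [Q_{C^{-1}(N)}] is
    the conjugate by [C] of the orthogonal projection onto [N]. *)
Lemma QopE N x : Qop C N x = iop_inv C (oprojL N (C x)).
Proof.
have [QQ Qr Qk] := QopLP C N.
have NQ : N (C (QopL C N x)).
  by rewrite -[N _]/((op_preim C N : set H) (QopL C N x)) Qr; exists x.
have : [set x | QopL C N x = 0] (x - QopL C N x).
  by rewrite /= linearB /= QQ subrr.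
rewrite Qk /= linearB /= => kO.
rewrite -[LHS](iopK C) /=; congr (iop_inv C _).
rewrite -[LHS](oproj_id NQ) -[C x in RHS](subrK (C (QopL C N x))) linearD /=.
have [_ _ kerp] := oprojLP N.
by move: kO; rewrite -kerp /= => ->; rewrite add0r.
Qed.

Lemma Qop_eq0 N x : Qop C N x = 0 <-> orth N (C x).
Proof.
have [_ _ Qk] := QopLP C N.
by rewrite -[Qop C N x = 0]/([set x | QopL C N x = 0] x) Qk.
Qed.

Lemma op_conjE N1 N2 (T : {linear N2 -> N1}) (x : op_preim C N2) (y : N2) :
  C (fdval x) = fdval y -> C (fdval (op_conj C T x)) = fdval (T y).
Proof.
move=> xy; rewrite /= iop_invK; congr (fdval (T _)).
exact: fdval_inj.
Qed.

Lemma op_preim_inj N (x y : op_preim C N) : C (fdval x) = C (fdval y) -> x = y.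
Proof. by move=> /(can_inj (iopK C)) /fdval_inj. Qed.

Definition op_image N (x : op_preim C N) : N :=
  to_fdvec (fdvecP x : N (C (fdval x))).

Lemma op_preim_mem N (y : N) : op_preim C N (iop_inv C (fdval y)).
Proof. by rewrite /= iop_invK; exact: fdvecP. Qed.

(** The inverse of the isomorphism from [C^{-1}(N)] onto [N] induced by [C]. *)
Definition op_lift N (y : N) : op_preim C N := to_fdvec (op_preim_mem y).

Lemma op_liftE N (y : N) : C (fdval (op_lift y)) = fdval y.
Proof. exact: iop_invK. Qed.

Lemma op_lift_surj N (x : op_preim C N) : exists n, op_lift n = x.
Proof.
by exists (op_image x); apply: op_preim_inj; rewrite op_liftE.
Qed.

Lemma op_conj_lift N1 N2 (T : {linear N2 -> N1}) (y : N2) :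
  op_conj C T (op_lift y) = op_lift (T y).
Proof.
by apply: op_preim_inj; rewrite op_liftE; apply: op_conjE; rewrite op_liftE.
Qed.

Lemma op_lift_inj N : injective (@op_lift N).
Proof. by move=> y z E; apply: fdval_inj; rewrite -(op_liftE y) E op_liftE. Qed.

Lemma op_lift_linear N : linear (@op_lift N).
Proof.
by move=> a x y; apply: op_preim_inj; rewrite op_liftE !linearP /= !iop_invK.
Qed.

Lemma op_conj_id N : op_conj C (idfun : {linear N -> N}) = idfun.
Proof.
apply: linear_ext => x; have [y <-] := op_lift_surj x.
by rewrite op_conj_lift.
Qed.

Lemma op_conj_comp N1 N2 N3 (T : {linear N2 -> N1}) (S : {linear N3 -> N2}) :
  op_conj C (T \o S) = op_conj C T \o op_conj C S.
Proof.
apply: linear_ext => x; have [y <-] := op_lift_surj x.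
rewrite op_conj_lift -[RHS]/(op_conj C T (op_conj C S (op_lift y))).
by rewrite !op_conj_lift.
Qed.

Lemma op_conj_inj N1 N2 : injective (@op_conj R k H C N1 N2).
Proof.
move=> T S E; apply: linear_ext => y; apply: op_lift_inj.
by rewrite -!op_conj_lift E.
Qed.

Lemma op_conj_surj N1 N2 (S : {linear op_preim C N2 -> op_preim C N1}) :
  exists T, op_conj C T = S.
Proof.
pose T (y : N2) := op_image (S (op_lift y)).
have TE (y : N2) : op_lift (T y) = S (op_lift y).
  by apply: op_preim_inj; rewrite op_liftE.
have Tl : linear T.
  move=> a y z; apply: op_lift_inj.
  by rewrite op_lift_linear !TE op_lift_linear linearP.
exists (HB.pack T (GRing.isLinear.Build _ _ _ _ _ Tl) : {linear N2 -> N1}).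
apply: linear_ext => x; have [y <-] := op_lift_surj x.
by rewrite op_conj_lift TE.
Qed.

End OpConj.

(** * The cross-connection *)

Lemma subobj_refl (X : subcat) (a : X) : subobj a a.
Proof. by exists (idm a); exact: incl_id. Qed.

Lemma subobj_fdP (K : fieldType) (V : lmodType K) (N M : fd_normalcat V) :
  subobj N M <-> forall x, (N : fdsub V) x -> (M : fdsub V) x.
Proof.
split=> [[j jI] x Nx|sub].
  by rewrite -[x]/(fdval (to_fdvec Nx)) -jI; exact: fdvecP.
have NM (x : (N : fdsub V)) : (M : fdsub V) (fdval x).
  by apply: sub; exact: fdvecP.
by exists (corestrict (f := @fdval _ V N) NM).
Qed.

Section GammaC.
Variables (R : realType) (k : scalar_kind) (H : hilbert R k).
Variable C : invertible_op H.
Local Notation K := (scalars R k).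
Local Notation FH := (fd_normalcat H).
Local Notation FH' := (fd_normalcat (dual H)).

Lemma Gamma_functor : is_functor (Gamma C).
Proof.
split=> [D|D1 D2 D3 phi psi].
  rewrite (Gamma_morE C (@represents_id _ _ _ (D : fdsub _))) op_conj_id.
  exact: mu_id.
have phiT := represented_represents (phi : {linear _ -> _}).
have psiT := represented_represents (psi : {linear _ -> _}).
rewrite (Gamma_morE C (represents_comp phiT psiT)) op_conj_comp.
exact: (@mu_comp _ _ (Qop C (predual D1)) (Qop C (predual D2))
  (Qop C (predual D3))).
Qed.

Lemma Gamma_fully_faithful : fully_faithful (Gamma C).
Proof.
move=> D1 D2; apply: inj_surj_bijective => [phi psi /mu_inj /op_conj_inj E|t].
  have phiT := represented_represents (phi : {linear _ -> _}).
  have psiT := represented_represents (psi : {linear _ -> _}).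
  by rewrite E in phiT; exact: represents_fun_inj phiT psiT.
have [S <-] := mu_surj t; have [T <-] := op_conj_surj S.
have [phi phiT] := represents_surj T.
by exists phi; exact: Gamma_morE.
Qed.

(** For [N1] inside [N2] the map [T : N2 -> N1] is the restriction of [P_{N1}].
    By [mu_incl] it remains to see that [Q_{C^{-1}(N2)}] followed by the
    conjugate of [T] is [Q_{C^{-1}(N1)}], which after conjugating by [C] is
    [oproj_oproj]. *)
Lemma Gamma_incl : incl_preserving (Gamma C).
Proof.
move=> D1 D2 phi phiI.
have phiT := represented_represents (phi : {linear _ -> _}).
rewrite (Gamma_morE C phiT); apply: mu_incl => x.
apply: (can_inj (iopK C)).
set T := represented _ in phiT *.
have sub y : predual D1 y -> predual D2 y.
  by apply: (subobj_fdP D1 D2).1; exists phi.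
pose y : predual D2 := fopcor (oproj (predual D2)) (C x).
rewrite (@op_conjE _ _ _ _ _ _ _ _ y); last first.
  by rewrite -[LHS]/(C (Qop C _ x)) QopE iop_invK.
rewrite (represents_incl phiI phiT) QopE iop_invK /=.
exact: oproj_oproj.
Qed.

(** Inclusions in the normal dual reverse the kernels of the idempotents, and
    passing from [N] to its orthogonal reverses inclusions again. *)
Lemma Gamma_reflects_subobj (D1 D2 : FH') :
  subobj (Gamma C D1) (Gamma C D2) -> subobj D1 D2.
Proof.
move=> [s /(incl_ker_sub (@Qop_idempotent _ _ _ C _)) kerQ].
apply/subobj_fdP/predual_sub/orth_anti => y.
by rewrite -[y](iop_invK C) => /Qop_eq0 /kerQ /Qop_eq0.
Qed.

Lemma Gamma_ob_inj : injective (fob (Gamma C)).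
Proof.
move=> D1 D2 E.
have [j1 j1I] : subobj D1 D2.
  by apply: Gamma_reflects_subobj; rewrite E; exact: subobj_refl.
have [j2 j2I] : subobj D2 D1.
  by apply: Gamma_reflects_subobj; rewrite E; exact: subobj_refl.
exact: incl_anti j1I j2I.
Qed.

(** The image under [C] of the kernel of [T], where the object [F] is
    [H(gamma^T, -)], contains the orthogonal of [N], where [D = N']; it is the
    orthogonal of some [M] inside [N] by [orth_above]. Then [T] has the same
    kernel as the idempotent attached to [M], and this forces
    [F = Gamma_C(M')]. *)
Lemma Gamma_ob_surj (D : FH') (F : ndual FH) :
  subobj F (Gamma C D) -> exists2 D0, subobj D0 D & Gamma C D0 = F.
Proof.
case: F => F FP [s sI]; have [e eI /esym FE] := FP.
case: F / FE FP s sI => FP s sI.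
have [T eT kerT] := incl_finop eI sI.
have [M [MN TM]] : exists M : fdsub H, (forall x, M x -> predual D x) /\
    (forall x, T (iop_inv C x) = 0 <-> orth M x).
  apply: (@orth_above _ _ _ (predual D) [set x | T (iop_inv C x) = 0]).
    split=> [|a x y xT yT]; first by rewrite /= !linear0.
    by rewrite /= !linearP xT yT scaler0 addr0.
  by move=> x xO; apply/kerT/Qop_eq0; rewrite iop_invK.
have kerQ x : T x = 0 <-> Qop C M x = 0.
  by rewrite Qop_eq0 -TM iopK.
exists (fd_dual M : FH').
  apply/subobj_fdP => _ [n Mn <-]; exact: MN.
rewrite Gamma_obE.
have [s1 s1I] := @ker_sub_incl _ _ (Qop C M) T (fun x => (kerQ x).1).
have [s2 s2I] := @ker_sub_incl _ _ T (Qop C M) (fun x => (kerQ x).2).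
move: FP {s sI}; rewrite eT => FP.
exact: (@incl_anti (ndual FH) (Hgamma (Qop_idempotent C M)) (NDualOb FP) s1 s2).
Qed.

Lemma Gamma_ideal (FI : incl_preserving (Gamma C)) (D : FH') :
  is_cat_iso (restrict FI D).
Proof.
split.
- by split=> *; [exact: Gamma_functor.1|exact: Gamma_functor.2].
- apply: inj_surj_bijective => [[D1 D1P] [D2 D2P] /(congr1 sval) /=|[F FP]].
    by move=> /Gamma_ob_inj E; apply: eq_exist.
  have [D0 D0P E] := Gamma_ob_surj FP.
  by exists (exist _ D0 D0P); apply: eq_exist.
- by move=> a b; exact: Gamma_fully_faithful.
Qed.

(** The idempotent attached to [M = C N] has range [N], so it restricts to an
    automorphism of [N]. *)
Lemma Gamma_Mset (N : FH) : exists D : FH', Mset (Gamma C D : ndual_ob FH) N.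
Proof.
pose M := fdrange (C \o @fdval K H N).
exists (fd_dual M : FH'); rewrite Gamma_obE; exists (gamma (Qop C M)) => //.
apply: fd_isoP => [x /= /Qop_eq0 xO|y].
  have Mx : M (C (fdval x)) by exists x.
  by rewrite -[LHS](iopK C) (orth_eq0 Mx xO) linear0.
have [n _ nE] := fdvecP y; exists n; apply: fdval_inj.
apply: (can_inj (iopK C)).
rewrite -[LHS]/(C (Qop C M (fdval n))) QopE iop_invK oproj_id; last by exists n.
exact: nE.
Qed.

End GammaC.

Theorem theorem3 (R : realType) (k : scalar_kind) (H : hilbert R k)
    (C : invertible_op H) :
  cross_connection (Gamma C).
Proof.
split; last exact: Gamma_Mset.
exact: (LocalIsomorphism (Gamma_functor C) (Gamma_fully_faithful C)
  (Gamma_ideal (@Gamma_incl _ _ _ C))).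
Qed.
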